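(* Let $k$ be a field, $S=k[x_1,\dots,x_n]$, $B\subset S$ an ideal generated by square-free monomials, and let $\phi:\mathbf{Z}^n\to\mathbf{D}$ be a surjective homomorphism of abelian groups, by which $S$ is $\mathbf{D}$-graded. Suppose that we have functions $f_i:\mathbf{D}\to\mathbf{N}^*$ ($i\ge 0$) such that the natural map $$\mathrm{Ext}^i_S(S/B^{[m]},S)_\delta\longrightarrow H^i_B(S)_\delta$$ is an isomorphism for every $\delta\in\mathbf{D}$, $i\ge 0$ and $m\ge f_i(\delta)$. Let $P$ be a finitely generated $\mathbf{D}$-graded $S$-module, and let $F_\bullet$ be a (graded) free resolution of $P$ with $$F_j=\bigoplus_{\alpha\in\mathbf{D}}S(-\alpha)^{\beta_{j,\alpha}} .$$ Let $i\ge0$ and $\delta\in\mathbf{D}$. Then the natural map $$\mathrm{Ext}^i_S(S/B^{[m]},P)_\delta\longrightarrow H^i_B(P)_\delta$$ is an isomorphism if for every $j\ge 0$ and every $\alpha\in\mathbf{D}$ such that $\beta_{j,\alpha}\ne 0$ we have $$m\ge\max\{f_{i+j-1}(\delta-\alpha),\,f_{i+j}(\delta-\alpha)\}\quad\text{if } j\ge 1,\qquad m\ge f_i(\delta-\alpha)\quad\text{if } j=0 .$$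
   Context: The $\mathbf{D}$-grading of $S$ is given by $\deg x_j=\phi(e_j)$; $S(-\alpha)$ is the free module with $S(-\alpha)_\epsilon=S_{\epsilon-\alpha}$. $\mathbf{N}^*$ is the set of positive integers. $B^{[m]}$ is the ideal generated by the $m$-th powers of the monomials in $B$. $H^i_B(P)$ is the $i$-th local cohomology of $P$ with supports in $B$, and the natural map $\mathrm{Ext}^i_S(S/B^{[m]},P)\to H^i_B(P)$ is the ($\mathbf{D}$-graded) map to the direct limit $H^i_B(P)=\varinjlim_m\mathrm{Ext}^i_S(S/B^{[m]},P)$. *)

(* Defs.v *)
From HB Require Import structures.
From mathcomp Require Import all_boot all_order all_algebra.
From mathcomp Require Import boolp classical_sets functions.
From mathcomp Require Import mpoly.

Set Implicit Arguments.
Unset Strict Implicit.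
Unset Printing Implicit Defensive.

Import GRing.Theory.
Local Open Scope ring_scope.
Local Open Scope quotient_scope.
Local Open Scope classical_set_scope.

Section LinearHom.
Variables (R : comNzRingType) (U V : lmodType R).

Definition linear_pred : {pred U -> V} := fun f => `[< linear f >].

Lemma linear_pred_closed : submod_closed linear_pred.
Proof.
split=> [|a f g /asboolP lf /asboolP lg]; apply/asboolP => b x y /=.
  by rewrite [LHS]/GRing.zero /= scaler0 addr0.
have e z : (a *: f + g) z = a *: f z + g z by [].
by rewrite !e lf lg !scalerDr !scalerA (mulrC a b) addrACA.
Qed.
HB.instance Definition _ :=
  GRing.isSubmodClosed.Build R (U -> V) linear_pred linear_pred_closed.

Record lhom := LHom { lhom_fun :> U -> V; _ : lhom_fun \in linear_pred }.
HB.instance Definition _ := [isSub for lhom_fun].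
HB.instance Definition _ := [Choice of lhom by <:].
HB.instance Definition _ := [SubChoice_isSubLmodule of lhom by <:].

Lemma lhom_linear (h : lhom) : linear h.
Proof. by case: h => f /= /asboolP. Qed.
HB.instance Definition _ (h : lhom) :=
  GRing.isLinear.Build R U V _ (lhom_fun h) (lhom_linear h).

Lemma lhomP (h h' : lhom) : h =1 h' -> h = h'.
Proof. by move=> e; apply/val_inj/funext. Qed.

Lemma lhomD (h h' : lhom) x : (h + h') x = h x + h' x. Proof. by []. Qed.
Lemma lhomN (h : lhom) x : (- h) x = - h x. Proof. by []. Qed.
Lemma lhomZ a (h : lhom) x : (a *: h) x = a *: h x. Proof. by []. Qed.
Lemma lhom0 x : (0 : lhom) x = 0. Proof. by []. Qed.

Definition mk_lhom (f : U -> V) (lf : linear f) : lhom := LHom (asboolT lf).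
End LinearHom.

Section LinearHomTheory.
Variables (R : comNzRingType).

Definition lhom_id (V : lmodType R) : lhom V V :=
  mk_lhom (fun a x y => erefl (a *: x + y)).

Fact lhom_comp_subproof (U V W : lmodType R) (g : lhom V W) (f : lhom U V) :
  linear (fun x => g (f x)).
Proof. by move=> a x y; rewrite !linearP. Qed.
Definition lhom_comp (U V W : lmodType R) (g : lhom V W) (f : lhom U V) :
  lhom U W := mk_lhom (lhom_comp_subproof g f).

Fact lhom_pre_subproof (U V P : lmodType R) (f : lhom U V) :
  linear (fun h : lhom V P => lhom_comp h f).
Proof. by move=> a h h'; apply/lhomP. Qed.
Definition lhom_pre (U V P : lmodType R) (f : lhom U V) :
  lhom (lhom V P) (lhom U P) := mk_lhom (lhom_pre_subproof f).

Section Kernel.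
Variables (U V : lmodType R) (f : lhom U V).
Definition ker_pred : {pred U} := fun x => f x == 0.
Lemma ker_pred_closed : submod_closed ker_pred.
Proof.
split=> [|a x y /eqP fx /eqP fy]; apply/eqP; first exact: linear0.
by rewrite linearP /= fx fy scaler0 addr0.
Qed.
HB.instance Definition _ :=
  GRing.isSubmodClosed.Build R U ker_pred ker_pred_closed.

Record kermod := KerMod { kermod_val :> U; _ : kermod_val \in ker_pred }.
HB.instance Definition _ := [isSub for kermod_val].
HB.instance Definition _ := [Choice of kermod by <:].
HB.instance Definition _ := [SubChoice_isSubLmodule of kermod by <:].

Lemma kermodP (x : kermod) : f x = 0.
Proof. by apply/eqP; case: x. Qed.

Definition mk_kermod x (fx : f x = 0) : kermod := KerMod (introT eqP fx).
End Kernel.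

Section Quotient.
Variables (V : lmodType R) (W : submodClosed V).

(* [Quotient.quot] asks for a [zmodClosed] predicate. *)
Definition submod_zmod : {pred V} := fun x => x \in W.
Fact submod_zmod_closed : zmod_closed submod_zmod.
Proof. exact: GRing.submod_closedB (submodClosedP W). Qed.
HB.instance Definition _ :=
  GRing.isZmodClosed.Build V submod_zmod submod_zmod_closed.

Definition quotmod := Quotient.quot submod_zmod.
HB.instance Definition _ := GRing.Zmodule.on quotmod.
HB.instance Definition _ := EqQuotient.on quotmod.

Definition quotmod_pi (x : V) : quotmod := \pi_quotmod x.
Definition quotmod_scale (a : R) (x : quotmod) : quotmod :=
  quotmod_pi (a *: repr x).

Lemma quotmod_eq x y : (quotmod_pi x = quotmod_pi y) <-> (x - y \in W).
Proof.
by rewrite -[x - y \in W]/(x - y \in submod_zmod) Quotient.idealrBE; split=> /eqP.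
Qed.

Lemma quotmod_repr x : quotmod_pi (repr x) = x.
Proof. exact: reprK. Qed.

Lemma quotmod_piD x y : quotmod_pi (x + y) = quotmod_pi x + quotmod_pi y.
Proof. exact: (Quotient.pi_add submod_zmod x y). Qed.

Lemma quotmod_piZ a x : quotmod_pi (a *: x) = quotmod_scale a (quotmod_pi x).
Proof.
apply/quotmod_eq; rewrite -scalerBr rpredZ //.
by apply/quotmod_eq; rewrite quotmod_repr.
Qed.

Lemma quotmod_ind (Q : quotmod -> Prop) :
  (forall x, Q (quotmod_pi x)) -> forall x, Q x.
Proof. by move=> h x; rewrite -(quotmod_repr x). Qed.

Fact quotmod_scaleA a b v :
  quotmod_scale a (quotmod_scale b v) = quotmod_scale (a * b) v.
Proof. by elim/quotmod_ind: v => v; rewrite -!quotmod_piZ scalerA. Qed.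
Fact quotmod_scale1 : left_id 1 quotmod_scale.
Proof. by elim/quotmod_ind => v; rewrite -!quotmod_piZ scale1r. Qed.
Fact quotmod_scaleDr : right_distributive quotmod_scale +%R.
Proof.
move=> a; elim/quotmod_ind=> v; elim/quotmod_ind=> w.
by rewrite -quotmod_piD -!quotmod_piZ -quotmod_piD scalerDr.
Qed.
Fact quotmod_scaleDl v : {morph quotmod_scale^~ v : a b / a + b}.
Proof.
by elim/quotmod_ind: v => v a b; rewrite -!quotmod_piZ -quotmod_piD scalerDl.
Qed.
HB.instance Definition _ := GRing.Zmodule_isLmodule.Build R quotmod
  quotmod_scaleA quotmod_scale1 quotmod_scaleDr quotmod_scaleDl.

Fact quotmod_pi_linear : linear quotmod_pi.
Proof. by move=> a x y; rewrite quotmod_piD quotmod_piZ. Qed.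
HB.instance Definition _ :=
  GRing.isLinear.Build R V quotmod _ quotmod_pi quotmod_pi_linear.
End Quotient.

Section QuotientMap.
Variables (V V' : lmodType R) (W : submodClosed V) (W' : submodClosed V').
Variables (f : lhom V V') (fW : forall x, x \in W -> f x \in W').

Let g (x : quotmod W) : quotmod W' := quotmod_pi W' (f (repr x)).
Let gE x : g (quotmod_pi W x) = quotmod_pi W' (f x).
Proof.
apply/quotmod_eq; rewrite -linearB; apply: fW.
by apply/quotmod_eq; rewrite quotmod_repr.
Qed.
Fact quotmod_map_subproof : linear g.
Proof.
move=> a; elim/quotmod_ind=> v; elim/quotmod_ind=> w.
by rewrite -linearP !gE !linearP.
Qed.
Definition quotmod_map : lhom (quotmod W) (quotmod W') :=
  mk_lhom quotmod_map_subproof.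
Lemma quotmod_mapE x : quotmod_map (quotmod_pi W x) = quotmod_pi W' (f x).
Proof. exact: gE. Qed.
End QuotientMap.

End LinearHomTheory.

Section Basis.
Variables (R : comNzRingType) (I : choiceType) (V : lmodType R) (b : I -> V).

Definition is_basis : Prop :=
  (forall x, exists s : seq I, exists c : I -> R,
     uniq s /\ x = \sum_(i <- s) c i *: b i) /\
  (forall (s : seq I) (c : I -> R), uniq s ->
     \sum_(i <- s) c i *: b i = 0 -> forall i, i \in s -> c i = 0).

Lemma basis_widen (N : lmodType R) (v : I -> N) (s t : seq I) (c : I -> R) :
    uniq s -> uniq t -> {subset s <= t} ->
  \sum_(i <- s) c i *: v i =
  \sum_(i <- t) (if i \in s then c i else 0) *: v i.
Proof.
move=> us ut st; rewrite (perm_big [seq i <- t | i \in s]) /=; last first.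
  apply: uniq_perm => //; first exact: filter_uniq.
  by move=> i; rewrite mem_filter; case: (boolP (i \in s)) => // /st ->.
rewrite big_filter big_mkcond /=; apply: eq_bigr => i _.
by case: ifP => // _; rewrite scale0r.
Qed.

Lemma basis_lhom (N : lmodType R) (v : I -> N) :
  is_basis -> exists h : lhom V N, forall i, h (b i) = v i.
Proof.
move=> [span free].
have [s_ /choice[c_ sc]] := choice span.
have key a (s1 s2 s3 : seq I) (c1 c2 c3 : I -> R) :
    uniq s1 -> uniq s2 -> uniq s3 ->
    \sum_(i <- s3) c3 i *: b i =
      a *: \sum_(i <- s1) c1 i *: b i + \sum_(i <- s2) c2 i *: b i ->
    \sum_(i <- s3) c3 i *: v i =
      a *: \sum_(i <- s1) c1 i *: v i + \sum_(i <- s2) c2 i *: v i.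
  move=> u1 u2 u3.
  pose t := undup (s1 ++ s2 ++ s3).
  have ut : uniq t by exact: undup_uniq.
  have t1 : {subset s1 <= t} by move=> i; rewrite mem_undup mem_cat => ->.
  have t2 : {subset s2 <= t}.
    by move=> i; rewrite mem_undup !mem_cat => ->; rewrite orbT.
  have t3 : {subset s3 <= t}.
    by move=> i; rewrite mem_undup !mem_cat => ->; rewrite !orbT.
  rewrite !(basis_widen _ _ u1 ut t1) !(basis_widen _ _ u2 ut t2).
  rewrite !(basis_widen _ _ u3 ut t3).
  set d1 := fun i => if i \in s1 then c1 i else 0.
  set d2 := fun i => if i \in s2 then c2 i else 0.
  set d3 := fun i => if i \in s3 then c3 i else 0.
  have comb (W : lmodType R) (w : I -> W) :
      a *: \sum_(i <- t) d1 i *: w i + \sum_(i <- t) d2 i *: w i =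
      \sum_(i <- t) (a * d1 i + d2 i) *: w i.
    rewrite scaler_sumr -big_split /=; apply: eq_bigr => i _.
    by rewrite scalerDl scalerA.
  rewrite !comb => /eqP; rewrite -subr_eq0 -sumrB => /eqP e.
  apply: eq_big_seq => i it; congr (_ *: _).
  apply/eqP; rewrite -subr_eq0; apply/eqP.
  apply: (free t (fun i => d3 i - (a * d1 i + d2 i)) ut _ i it).
  by rewrite -[RHS]e; apply: eq_bigr => j _; rewrite scalerBl.
have us x : uniq (s_ x) by case: (sc x).
have E x : \sum_(i <- s_ x) c_ x i *: b i = x by case: (sc x).
pose h x := \sum_(i <- s_ x) c_ x i *: v i.
have lh : linear h.
  by move=> a x y; apply: key => //; rewrite !E.
exists (mk_lhom lh) => i /=.
have := @key 0 [::] [:: i] (s_ (b i)) (fun=> 0) (fun=> 1) (c_ (b i)).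
rewrite !big_nil !big_cons !big_nil !scaler0 !add0r !addr0 !scale1r.
by apply=> //; rewrite E.
Qed.
End Basis.

Section Resolutions.
Variable R : comNzRingType.

(* The morphisms [lhom] are linear maps, packed so that [lhom U V] is itself the
   module Hom_R(U, V). *)
Record free_resolution (M : lmodType R) := FreeResolution {
  res_mod :> nat -> lmodType R;
  res_idx : nat -> choiceType;
  res_gen : forall j, res_idx j -> res_mod j;
  res_basis : forall j, is_basis (@res_gen j);
  res_d : forall j, lhom (res_mod j.+1) (res_mod j);
  res_aug : lhom (res_mod 0) M;
  res_aug_surj : forall x, exists y, res_aug y = x;
  res_exact0 : forall x, res_aug x = 0 <-> exists y, res_d 0 y = x;
  res_exact : forall j x, res_d j x = 0 <-> exists y, res_d j.+1 y = x }.

Section Ext.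
Variables (M : lmodType R) (G : free_resolution M) (P : lmodType R) (i : nat).

Definition cocycle := kermod (lhom_pre P (res_d G i)).

Definition coboundary : lhom (G i) P -> Prop :=
  match i return lhom (G i) P -> Prop with
  | 0 => fun z => z = 0
  | j.+1 => fun z => exists w : lhom (G j) P, z = lhom_comp w (res_d G j)
  end.

Definition coboundary_pred : {pred cocycle} :=
  fun z => `[< coboundary (kermod_val z) >].

Fact coboundary_pred_closed : submod_closed coboundary_pred.
Proof.
split=> [|a x y /asboolP + /asboolP +]; last move=> hx hy; apply/asboolP.
  rewrite -[kermod_val 0]/(0 : lhom (G i) P) /coboundary.
  by case: i => // j; exists 0; apply/lhomP.
rewrite -[kermod_val _]/(a *: kermod_val x + kermod_val y).
move: (kermod_val x) (kermod_val y) hx hy; rewrite /coboundary.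
case: i => [|j] {}x {}y; first by move=> -> ->; rewrite scaler0 addr0.
by move=> [u ->] [v ->]; exists (a *: u + v); apply/lhomP.
Qed.
HB.instance Definition _ := GRing.isSubmodClosed.Build R cocycle
  coboundary_pred coboundary_pred_closed.

(* Ext^i_R(M, P), computed as H^i(Hom_R(G, P)) for a free resolution G of M. *)
Definition Ext : lmodType R := quotmod coboundary_pred.
End Ext.

Section Comparison.
Variables (M N : lmodType R) (G : free_resolution M) (Q : free_resolution N).

Record chain_map (f : lhom M N) := ChainMap {
  cm_map :> forall j, lhom (G j) (Q j);
  cm_aug : forall x, res_aug Q (cm_map 0 x) = f (res_aug G x);
  cm_d : forall j x, res_d Q j (cm_map j.+1 x) = cm_map j (res_d G j x) }.

Lemma res_dd j x : res_d G j (res_d G j.+1 x) = 0.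
Proof. by apply/res_exact; exists x. Qed.

Lemma free_lift j (V W : lmodType R) (p : lhom V W) (g : lhom (G j) W) :
    (forall x, exists y, p y = g x) ->
  exists h : lhom (G j) V, forall x, p (h x) = g x.
Proof.
move=> lift; have [v vP] := choice (fun i => lift (@res_gen _ G j i)).
have [h hP] := basis_lhom v (res_basis G j).
exists h => x; have [s [c [_ ->]]] := (res_basis G j).1 x.
by rewrite !linear_sum; apply: eq_bigr => i _; rewrite !linearZ /= hP vP.
Qed.

Lemma chain_map_exists (f : lhom M N) : exists c : chain_map f, True.
Proof.
have [h0 h0P] : exists h : lhom (G 0) (Q 0),
    forall x, res_aug Q (h x) = f (res_aug G x).
  apply: (@free_lift 0 _ _ (res_aug Q) (lhom_comp f (res_aug G))) => x.
  exact: res_aug_surj.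
have [h1 h1P] : exists h : lhom (G 1) (Q 1),
    forall x, res_d Q 0 (h x) = h0 (res_d G 0 x).
  apply: (@free_lift 1 _ _ (res_d Q 0) (lhom_comp h0 (res_d G 0))) => x /=.
  apply/res_exact0; rewrite h0P (_ : res_aug G _ = 0) ?linear0 //.
  by apply/res_exact0; exists x.
pose T j := {p : lhom (G j) (Q j) * lhom (G j.+1) (Q j.+1) |
              forall x, res_d Q j (p.2 x) = p.1 (res_d G j x)}.
have next j (t : T j) :
    {q : lhom (G j.+2) (Q j.+2) | forall x, res_d Q j.+1 (q x) = (sval t).2 (res_d G j.+1 x)}.
  apply/cid; case: t => -[p q] /= pq.
  apply: (@free_lift j.+2 _ _ (res_d Q j.+1)
            (lhom_comp q (res_d G j.+1))) => x /=.
  by apply/res_exact; rewrite pq res_dd linear0.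
pose t := fix t j : T j := match j return T j with
  | 0 => exist _ (h0, h1) h1P
  | j.+1 => exist _ ((sval (t j)).2, sval (next j (t j))) (svalP (next j (t j)))
  end.
unshelve eexists; last by [].
exists (fun j => (sval (t j)).1) => //.
by move=> j x; exact: (svalP (t j)).
Qed.

Lemma chain_map_homotopy (f : lhom M N) (c c' : chain_map f) (P : lmodType R)
    (i : nat) (phi : lhom (Q i) P) :
  (forall x, phi (res_d Q i x) = 0) ->
  @coboundary M G P i (lhom_comp phi (c i) - lhom_comp phi (c' i)).
Proof.
have lift0 (u : lhom (G 0) (Q 0)) : (forall x, res_aug Q (u x) = 0) ->
    exists t : lhom (G 0) (Q 1), forall x, res_d Q 0 (t x) = u x.
  by move=> u0; apply: free_lift => x; apply/res_exact0.
have liftS j (u : lhom (G j.+1) (Q j.+1)) :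
    (forall x, res_d Q j (u x) = 0) ->
    exists t : lhom (G j.+1) (Q j.+2), forall x, res_d Q j.+1 (t x) = u x.
  by move=> u0; apply: free_lift => x; apply/res_exact.
pose g j : lhom (G j) (Q j) := c j - c' j.
have gd j x : res_d Q j (g j.+1 x) = g j (res_d G j x).
  by rewrite /g !lhomD !lhomN linearB /= !cm_d.
have [t0 t0P] : exists t : lhom (G 0) (Q 1), forall x, res_d Q 0 (t x) = g 0 x.
  by apply: lift0 => x; rewrite lhomD lhomN linearB /= !cm_aug subrr.
have hS j (t : lhom (G j) (Q j.+1)) :
    (forall x, res_d Q j (t (res_d G j x)) = g j (res_d G j x)) ->
    exists s : lhom (G j.+1) (Q j.+2),
      forall x, res_d Q j.+1 (s x) = g j.+1 x - t (res_d G j x).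
  move=> tP; apply: (liftS j (g j.+1 - lhom_comp t (res_d G j))) => x.
  by rewrite lhomD lhomN linearB /= gd tP subrr.
have ht j : exists t : lhom (G j) (Q j.+1),
    forall x, res_d Q j (t (res_d G j x)) = g j (res_d G j x).
  elim: j => [|j [t /hS[s sP]]]; first by exists t0.
  by exists s => x; rewrite sP res_dd linear0 subr0.
case: i phi => [|i] phi phid /=.
  apply/lhomP => x; rewrite lhomD lhomN lhom0 /= -linearB /=.
  by rewrite -[c 0 x - c' 0 x]/(g 0 x) -t0P phid.
have [t /hS[s sP]] := ht i; exists (lhom_comp phi t); apply/lhomP => x.
rewrite lhomD lhomN /= -linearB /= -[c i.+1 x - c' i.+1 x]/(g i.+1 x).
by rewrite -(subrK (t (res_d G i x)) (g i.+1 x)) -sP linearD /= phid add0r.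
Qed.

Section ExtChainMap.
Variables (f : lhom M N) (c : chain_map f) (P : lmodType R) (i : nat).

Fact cocycle_pull_subproof (z : cocycle Q P i) :
  lhom_pre P (res_d G i) (lhom_comp (kermod_val z) (c i)) = 0.
Proof.
apply/lhomP => x /=; rewrite -cm_d.
by have /(congr1 (fun h : lhom _ _ => h (c i.+1 x))) := kermodP z.
Qed.

Fact cocycle_pull_linear :
  linear (fun z : cocycle Q P i => mk_kermod (cocycle_pull_subproof z)).
Proof. by move=> a x y; apply/val_inj/lhomP. Qed.

Definition cocycle_pull : lhom (cocycle Q P i) (cocycle G P i) :=
  mk_lhom cocycle_pull_linear.

Fact cocycle_pull_coboundary z :
  z \in @coboundary_pred N Q P i -> cocycle_pull z \in @coboundary_pred M G P i.
Proof.
move=> /asboolP hz; apply/asboolP; move: hz.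
rewrite -[kermod_val (cocycle_pull z)]/(lhom_comp (kermod_val z) (c i)).
move: (kermod_val z); case: i => [|j] y /=; first by move=> ->; apply/lhomP.
move=> [w ->]; exists (lhom_comp w (c j)); apply/lhomP => x /=.
by rewrite cm_d.
Qed.

Definition Ext_chain_map : lhom (Ext Q P i) (Ext G P i) :=
  quotmod_map cocycle_pull_coboundary.

Lemma Ext_chain_mapE z :
  Ext_chain_map (quotmod_pi _ z) = quotmod_pi _ (cocycle_pull z).
Proof. exact: quotmod_mapE. Qed.
End ExtChainMap.

Lemma Ext_chain_map_indep (f : lhom M N) (c c' : chain_map f) P i :
  Ext_chain_map c P i = Ext_chain_map c' P i.
Proof.
apply/lhomP; elim/quotmod_ind => z; rewrite !Ext_chain_mapE.
apply/quotmod_eq/asboolP; apply: chain_map_homotopy => x.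
by have /(congr1 (fun h : lhom _ _ => h x)) := kermodP z.
Qed.

(* Ext^i(N, P) -> Ext^i(M, P) induced by f : M -> N, through any lift of f
   (see [Ext_chain_map_indep]). *)
Definition Ext_map (f : lhom M N) P i : lhom (Ext Q P i) (Ext G P i) :=
  Ext_chain_map (projT1 (cid (chain_map_exists f))) P i.

Lemma Ext_mapE (f : lhom M N) (c : chain_map f) P i :
  Ext_map f P i = Ext_chain_map c P i.
Proof. exact: Ext_chain_map_indep. Qed.
End Comparison.

Lemma Ext_map_id (M : lmodType R) (G : free_resolution M) (f : lhom M M) P i x :
  (forall y, f y = y) -> Ext_map G G f P i x = x.
Proof.
move=> fid; unshelve erewrite Ext_mapE.
  exists (fun j => lhom_id (G j)); last by [].
  by move=> y; rewrite fid.
elim/quotmod_ind: x => z; rewrite Ext_chain_mapE; congr quotmod_pi.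
exact/val_inj/lhomP.
Qed.

Lemma Ext_map_comp (L M N : lmodType R) (H : free_resolution L)
    (G : free_resolution M) (Q : free_resolution N)
    (f : lhom L M) (g : lhom M N) (h : lhom L N) P i x :
  (forall y, g (f y) = h y) ->
  Ext_map H G f P i (Ext_map G Q g P i x) = Ext_map H Q h P i x.
Proof.
move=> gf.
have [c _] := chain_map_exists H G f; have [e _] := chain_map_exists G Q g.
unshelve erewrite (Ext_mapE (f := h)).
  exists (fun j => lhom_comp (e j) (c j)) => [y|j y] /=.
    by rewrite cm_aug cm_aug gf.
  by rewrite !cm_d.
rewrite (Ext_mapE c) (Ext_mapE e).
elim/quotmod_ind: x => z; rewrite (Ext_chain_mapE e) !Ext_chain_mapE; congr quotmod_pi.
exact/val_inj/lhomP.
Qed.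
End Resolutions.

Section DirectLimit.
Variable R : comNzRingType.

Record direct_system := DirectSystem {
  ds_obj :> nat -> lmodType R;
  ds_map : forall m m', (m <= m')%N -> lhom (ds_obj m) (ds_obj m');
  ds_id : forall m (h : (m <= m)%N) x, ds_map h x = x;
  ds_comp : forall m m' m'' (h : (m <= m')%N) (h' : (m' <= m'')%N)
      (h'' : (m <= m'')%N) x,
    ds_map h' (ds_map h x) = ds_map h'' x }.

Variable A : direct_system.

Definition dl_pre := {m : nat & A m}.
HB.instance Definition _ := Choice.on dl_pre.

Definition dl_equiv (u v : dl_pre) : bool :=
  `[< exists m (h : (tag u <= m)%N) (h' : (tag v <= m)%N),
        ds_map A h (tagged u) = ds_map A h' (tagged v) >].

Fact dl_equiv_class : equiv_class_of dl_equiv.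
Proof.
split=> [u|u v|v u w].
- by apply/asboolP; exists (tag u), (leqnn _), (leqnn _).
- by apply/idP/idP => /asboolP[m [h [h' e]]]; apply/asboolP; exists m, h', h.
move=> /asboolP[m [h [h' e]]] /asboolP[m1 [k [k' e1]]]; apply/asboolP.
exists (maxn m m1), (leq_trans h (leq_maxl _ _)), (leq_trans k' (leq_maxr _ _)).
rewrite -(ds_comp h (leq_maxl m m1)) e -(ds_comp k' (leq_maxr m m1)) -e1.
by rewrite !(ds_comp _ _ (leq_trans k (leq_maxr _ _))).
Qed.
Canonical dl_equiv_rel := EquivRelPack dl_equiv_class.
Canonical dl_equiv_enc := defaultEncModRel dl_equiv.

Definition dirlim := {eq_quot dl_equiv}.
HB.instance Definition _ := EqQuotient.on dirlim.
HB.instance Definition _ := Choice.on dirlim.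

Definition dl_in m (x : A m) : dirlim := \pi_dirlim (Tagged (fun j => A j : Type) x : dl_pre).

Lemma dl_inP m m' (x : A m) (y : A m') :
  dl_in x = dl_in y <->
  exists p (h : (m <= p)%N) (h' : (m' <= p)%N), ds_map A h x = ds_map A h' y.
Proof.
split=> [/eqP|e]; last by apply/eqP; rewrite /dl_in eqmodE; apply/asboolP.
by rewrite /dl_in eqmodE => /asboolP.
Qed.

Lemma dl_in_map m m' (h : (m <= m')%N) (x : A m) :
  dl_in (ds_map A h x) = dl_in x.
Proof. by apply/dl_inP; exists m', (leqnn m'), h; rewrite ds_id. Qed.

Lemma dirlim_ind (Q : dirlim -> Prop) :
  (forall m (x : A m), Q (dl_in x)) -> forall u, Q u.
Proof. by move=> h u; rewrite -[u]reprK; case: (repr u) => m x; exact: h. Qed.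

(* Any two elements of the limit live at a common stage. *)
Lemma dirlim_ind2 (Q : dirlim -> dirlim -> Prop) :
  (forall m (x y : A m), Q (dl_in x) (dl_in y)) -> forall u v, Q u v.
Proof.
move=> h; elim/dirlim_ind => m x; elim/dirlim_ind => m' y.
by rewrite -(dl_in_map (leq_maxl m m') x) -(dl_in_map (leq_maxr m m') y).
Qed.

Definition dl_add (u v : dirlim) : dirlim :=
  dl_in (ds_map A (leq_maxl (tag (repr u)) (tag (repr v))) (tagged (repr u)) +
         ds_map A (leq_maxr (tag (repr u)) (tag (repr v))) (tagged (repr v))).
Definition dl_scale (a : R) (u : dirlim) : dirlim :=
  dl_in (a *: tagged (repr u)).

Lemma dl_repr u : dl_in (tagged (repr u)) = u.
Proof. by rewrite -[RHS]reprK; case: (repr u). Qed.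

Lemma dl_addE m (x y : A m) : dl_add (dl_in x) (dl_in y) = dl_in (x + y).
Proof.
have := dl_repr (dl_in x); have := dl_repr (dl_in y); rewrite /dl_add.
case: (repr (dl_in x)) => m1 x1; case: (repr (dl_in y)) => m2 y1 /=.
move=> /dl_inP[p2 [h2 [k2 e2]]] /dl_inP[p1 [h1 [k1 e1]]].
set q := maxn p1 p2.
have p1q : (p1 <= q)%N by exact: leq_maxl.
have p2q : (p2 <= q)%N by exact: leq_maxr.
have mq : (maxn m1 m2 <= q)%N.
  by rewrite geq_max (leq_trans h1 p1q) (leq_trans h2 p2q).
apply/dl_inP; exists q, mq, (leq_trans k1 p1q); rewrite !linearD /=.
rewrite !(ds_comp _ mq (leq_trans h1 p1q)) !(ds_comp _ mq (leq_trans h2 p2q)).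
rewrite -(ds_comp h1 p1q) e1 -(ds_comp h2 p2q) e2.
by rewrite (ds_comp k1 p1q (leq_trans k1 p1q)) (ds_comp k2 p2q (leq_trans k1 p1q)).
Qed.

Lemma dl_scaleE a m (x : A m) : dl_scale a (dl_in x) = dl_in (a *: x).
Proof.
have := dl_repr (dl_in x); rewrite /dl_scale.
case: (repr (dl_in x)) => m1 x1 /= /dl_inP[p [h [k e]]].
by apply/dl_inP; exists p, h, k; rewrite !linearZ /= e.
Qed.

Definition dl_zero : dirlim := dl_in (0 : A 0).
Definition dl_opp := dl_scale (-1).

Lemma dl_zeroE m : dl_in (0 : A m) = dl_zero.
Proof. by apply/dl_inP; exists m, (leqnn m), (leq0n m); rewrite !linear0. Qed.

Fact dl_addC : commutative dl_add.
Proof. by apply: dirlim_ind2 => m x y; rewrite !dl_addE addrC. Qed.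
Fact dl_addA : associative dl_add.
Proof.
elim/dirlim_ind => p x; apply: dirlim_ind2 => m y z.
have e q : dl_in x = dl_in (ds_map A (leq_maxl p q) x) by rewrite dl_in_map.
rewrite (e m) -(dl_in_map (leq_maxr p m) y) -(dl_in_map (leq_maxr p m) z).
by rewrite !dl_addE addrA.
Qed.
Fact dl_add0 : left_id dl_zero dl_add.
Proof. by elim/dirlim_ind => m x; rewrite -(dl_zeroE m) dl_addE add0r. Qed.
Fact dl_addN : left_inverse dl_zero dl_opp dl_add.
Proof.
elim/dirlim_ind => m x.
by rewrite /dl_opp dl_scaleE dl_addE scaleN1r addNr dl_zeroE.
Qed.
HB.instance Definition _ :=
  GRing.isZmodule.Build dirlim dl_addA dl_addC dl_add0 dl_addN.

Fact dl_scaleA a b v : dl_scale a (dl_scale b v) = dl_scale (a * b) v.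
Proof. by elim/dirlim_ind: v => m x; rewrite !dl_scaleE scalerA. Qed.
Fact dl_scale1 : left_id 1 dl_scale.
Proof. by elim/dirlim_ind => m x; rewrite dl_scaleE scale1r. Qed.
Fact dl_scaleDr : right_distributive dl_scale +%R.
Proof.
move=> a; apply: dirlim_ind2 => m x y.
by rewrite [_ + _]dl_addE !dl_scaleE [RHS]dl_addE scalerDr.
Qed.
Fact dl_scaleDl v : {morph dl_scale^~ v : a b / a + b}.
Proof.
elim/dirlim_ind: v => m x a b /=.
by rewrite !dl_scaleE [RHS]dl_addE scalerDl.
Qed.
HB.instance Definition _ := GRing.Zmodule_isLmodule.Build R dirlim
  dl_scaleA dl_scale1 dl_scaleDr dl_scaleDl.

Fact dl_in_linear m : linear (@dl_in m).
Proof. by move=> a x y; rewrite -dl_addE -dl_scaleE. Qed.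
Definition dl_map m : lhom (A m) dirlim := mk_lhom (@dl_in_linear m).
End DirectLimit.

Section IdealGen.
Variables (R : comNzRingType) (A : set R).

Definition ideal_gen : {pred R^o} := fun p =>
  `[< exists s : seq (R * R),
        (forall x, x \in s -> A x.2) /\ p = \sum_(x <- s) x.1 * x.2 >].

Fact ideal_gen_closed : submod_closed ideal_gen.
Proof.
split=> [|a p q /asboolP[s [sA ->]] /asboolP[t [tA ->]]]; apply/asboolP.
  by exists [::]; rewrite big_nil.
exists ([seq (a * x.1, x.2) | x <- s] ++ t); split=> [x|].
  by rewrite mem_cat => /orP[/mapP[y ys ->]|/tA//]; exact: sA ys.
rewrite big_cat big_map scaler_sumr /=; congr (_ + _).
by apply: eq_bigr => x _; rewrite [LHS]mulrA.
Qed.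
HB.instance Definition _ :=
  GRing.isSubmodClosed.Build R R^o ideal_gen ideal_gen_closed.

Lemma ideal_gen_mem p : A p -> p \in ideal_gen.
Proof.
move=> Ap; apply/asboolP; exists [:: (1, p)]; split=> [x|].
  by rewrite inE => /eqP->.
by rewrite big_seq1 mul1r.
Qed.
End IdealGen.

Lemma ideal_gen_sub (R : comNzRingType) (A A' : set R) :
  (forall p, A p -> p \in ideal_gen A') -> {subset ideal_gen A <= ideal_gen A'}.
Proof.
move=> AA' p /asboolP[s [sA ->]]; rewrite big_seq.
by apply: rpred_sum => x /sA /AA' h; exact: (rpredZ x.1 h).
Qed.

Section Monomial.
Variables (k : fieldType) (n : nat).
Local Notation S := {mpoly k[n]}.

Definition squarefree_monomial_ideal (B : {pred S^o}) : Prop :=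
  exists A : set 'X_{1..n},
    (forall u, A u -> forall i, (u i <= 1)%N) /\
    B = ideal_gen [set p : S | exists2 u, A u & p = 'X_[u]].

Variable B : {pred S^o}.

Definition bracket_power (m : nat) : {pred S^o} :=
  ideal_gen [set p : S | exists2 u : 'X_{1..n}, 'X_[u] \in B & p = 'X_[u] ^+ m].
HB.instance Definition _ m := GRing.SubmodClosed.on (bracket_power m).

Lemma bracket_power_le m m' :
  (m <= m')%N -> {subset bracket_power m' <= bracket_power m}.
Proof.
move=> mm'; apply: ideal_gen_sub => p [u Bu ->].
rewrite -(subnK mm') exprD; apply: (rpredZ (_ : S)).
by apply: ideal_gen_mem; exists u.
Qed.

Definition quot_bracket m : lmodType S := quotmod (bracket_power m).

Definition quot_bracket_proj m m' (h : (m <= m')%N) :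
    lhom (quot_bracket m') (quot_bracket m) :=
  quotmod_map (f := lhom_id S^o) (bracket_power_le h).

Lemma quot_bracket_projE m m' (h : (m <= m')%N) p :
  quot_bracket_proj h (quotmod_pi _ p) = quotmod_pi _ p.
Proof. exact: quotmod_mapE. Qed.

Variables (G : forall m, free_resolution (quot_bracket m)).
Variables (P : lmodType S) (i : nat).

Fact Ext_bracket_id m (h : (m <= m)%N) x :
  Ext_map (G m) (G m) (quot_bracket_proj h) P i x = x.
Proof.
by apply: Ext_map_id; elim/quotmod_ind => y; rewrite [LHS]quotmod_mapE.
Qed.

Fact Ext_bracket_comp m m' m'' (h : (m <= m')%N) (h' : (m' <= m'')%N)
    (h'' : (m <= m'')%N) x :
  Ext_map (G m'') (G m') (quot_bracket_proj h') P i
    (Ext_map (G m') (G m) (quot_bracket_proj h) P i x) =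
  Ext_map (G m'') (G m) (quot_bracket_proj h'') P i x.
Proof.
apply: Ext_map_comp; elim/quotmod_ind => y.
by rewrite (quot_bracket_projE h' y) !quot_bracket_projE.
Qed.

Definition Ext_bracket_system : direct_system S :=
  DirectSystem Ext_bracket_id Ext_bracket_comp.

(* H^i_B(P), the direct limit over m of the modules Ext^i(S/B^[m], P). *)
Definition local_cohomology : lmodType S := dirlim Ext_bracket_system.

(* The natural map is linear, so on graded pieces it is an isomorphism as soon
   as it is bijective. *)
Definition Ext_to_local_cohomology m :
  lhom (Ext (G m) P i) local_cohomology := dl_map Ext_bracket_system m.
End Monomial.

Section Graded.
Variables (k : fieldType) (n : nat) (D : zmodType).
Variable phi : {additive 'rV[int]_n -> D}.
Local Notation S := {mpoly k[n]}.

Definition mdegD (u : 'X_{1..n}) : D := \sum_(i < n) phi (delta_mx 0 i) *+ u i.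

Definition poly_grading (d : D) : set S^o :=
  [set p | forall u, u \in msupp (p : S) -> mdegD u = d].

Record is_graded (P : lmodType S) (Pg : D -> set P) : Prop := IsGraded {
  gr_zero : forall d, Pg d 0;
  gr_add : forall d x y, Pg d x -> Pg d y -> Pg d (x + y);
  gr_act : forall d e (p : S) x,
    poly_grading d p -> Pg e x -> Pg (d + e) (p *: x);
  gr_span : forall x, exists (s : seq D) (y : D -> P),
    (forall d, Pg d (y d)) /\ x = \sum_(d <- s) y d;
  gr_direct : forall (s : seq D) (y : D -> P), uniq s ->
    (forall d, Pg d (y d)) -> \sum_(d <- s) y d = 0 ->
    forall d, d \in s -> y d = 0 }.

Definition finitely_generated (P : lmodType S) : Prop :=
  exists (r : nat) (g : 'I_r -> P),
    forall x, exists c : 'I_r -> S, x = \sum_i c i *: g i.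

Definition quotient_grading (W : submodClosed S^o) (d : D) : set (quotmod W) :=
  quotmod_pi W @` poly_grading d.

(* For a free module V with basis b, b i placed in degree deg i, i.e. for
   V = \bigoplus_i S(- deg i): as S(-a)_d = S_(d - a), the elements of degree d
   are the combinations whose i-th coefficient has degree d - deg i. *)
Definition free_grading (I : choiceType) (V : lmodType S) (b : I -> V)
    (deg : I -> D) (d : D) : set V :=
  [set x | exists (s : seq I) (c : I -> S),
    (forall i, i \in s -> poly_grading (d - deg i) (c i)) /\
    x = \sum_(i <- s) c i *: b i].

Definition homogeneous_map (U V : lmodType S) (Ug : D -> set U)
    (Vg : D -> set V) (d : D) (h : lhom U V) : Prop :=
  forall e x, Ug e x -> Vg (e + d) (h x).

Record graded_free_resolution (M : lmodType S) (Mg : D -> set M) :=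
  GradedFreeResolution {
    gres :> free_resolution M;
    gres_deg : forall j, res_idx gres j -> D;
    gres_d_homog : forall j, homogeneous_map
      (free_grading (@res_gen _ _ gres j.+1) (@gres_deg j.+1))
      (free_grading (@res_gen _ _ gres j) (@gres_deg j)) 0 (res_d gres j);
    gres_aug_homog : homogeneous_map
      (free_grading (@res_gen _ _ gres 0) (@gres_deg 0)) Mg 0 (res_aug gres) }.

Definition gres_grading (M : lmodType S) (Mg : D -> set M)
    (G : graded_free_resolution Mg) (j : nat) : D -> set (G j) :=
  free_grading (@res_gen _ _ G j) (@gres_deg _ _ G j).
Arguments gres_grading {M Mg} G j _ _.

(* F_j = \bigoplus_a S(-a)^(beta_(j,a)), the multiplicity beta_(j,a) being the
   (possibly infinite) number of basis elements of F_j of degree a. *)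
Definition betti_neq0 (M : lmodType S) (Mg : D -> set M)
    (F : graded_free_resolution Mg) (j : nat) (a : D) : Prop :=
  exists e : res_idx F j, gres_deg e = a.

(* Ext^i(M, P)_d: the classes of the cocycles G_i -> P of degree d.  When M
   is finitely generated, Ext^i(M, P) is the direct sum of these pieces for any
   choice of G, even if the G_i are not finitely generated. *)
Definition Ext_grading (M : lmodType S) (Mg : D -> set M)
    (G : graded_free_resolution Mg) (P : lmodType S) (Pg : D -> set P)
    (i : nat) (d : D) : set (Ext G P i) :=
  quotmod_pi (@coboundary_pred _ _ G P i) @`
    [set z | homogeneous_map (gres_grading G i) Pg d (kermod_val z)].

Definition local_cohomology_grading (B : {pred S^o})
    (G : forall m,
           graded_free_resolution (@quotient_grading (bracket_power B m)))
    (P : lmodType S) (Pg : D -> set P) (i : nat) (d : D) :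
    set (local_cohomology G P i) :=
  \bigcup_m (Ext_to_local_cohomology G P i m @` @Ext_grading _ _ (G m) _ Pg i d).

End Graded.

Arguments quotient_grading {k n D} phi W d _.
Arguments gres_grading {k n D phi M Mg} G j _ _.
Arguments Ext_grading {k n D phi M Mg} G {P} Pg i d _.
Arguments local_cohomology_grading {k n D phi B} G {P} Pg i d _.
Arguments Ext_to_local_cohomology {k n B} G P i m.
Arguments betti_neq0 {k n D phi M Mg} F j a.

(* Main.v *)
Require Import Defs.
From HB Require Import structures.
From mathcomp Require Import all_boot all_order all_algebra.
From mathcomp Require Import boolp classical_sets functions.
From mathcomp Require Import mpoly.
From mathcomp Require Import zify.

(** Replace each resolution of [S / B^[m]] by a Taylor resolution. If [B] is
    generated by the square-free monomials with supports [L j], then [B^[m]] is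
    generated by their [m]-th powers, the Taylor resolution on these has as basis
    the faces [I] of a simplex, in degree [m] times the union of the [L j], [j] in
    [I], and the resolution for [m' >= m] is a subcomplex of the one for [m]. Thus
    [Ext^i(S/B^[m], P)_d -> Ext^i(S/B^[m'], P)_d] is induced by an explicit map
    [cshift] between finite complexes of cochains with values in homogeneous
    pieces of [P], functorially in [P]. It suffices to show that this map is
    bijective for all [m' >= m] ([local_cohomology_bij]).

    For [P] free the map is always injective ([ext_inj_free]): discarding the terms
    that are not divisible by the monomials of [cshift] is a retraction of
    complexes, because square-free monomials enter with exponent exactly [m]
    ([mdivX_taylor_coef]). Hence, as soon as [m >= f_i(d)], the assumed
    isomorphism with the limit gives surjectivity for [S] at every [m' >= m]
    ([ext_surj_of_bij]), and a cochain with values in a free module involves only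
    finitely many coordinates ([ext_surj_free]).

    For general [P], let [Z] be a syzygy, covered by the free module [Y] with kernel
    the next syzygy [K]. The two four lemmas read
    - surjectivity for [Z] in degree [q] follows from surjectivity for [Y] in
      degree [q] and for [K] in degree [q + 1], and injectivity for [Y];
    - injectivity for [Z] in degree [q] follows from surjectivity for [K] in
      degree [q], injectivity for [K] in degree [q + 1], and injectivity for [Y].
    There are no cochains in degrees beyond the number of generators, so the
    induction stops, and it has used surjectivity for [F_j] in degree [i + j] for
    all [j], and in degree [i + j - 1] for [j >= 1] ([ext_surj_module],
    [ext_inj_module]). These are the degrees in the hypothesis on [m].

    The passage between the given resolutions and those of Taylor respects degrees
    because a lift of a homogeneous map to graded resolutions can be replaced by its
    component of degree [0] ([graded_chain_map]). *)

Set Implicit Arguments.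
Unset Strict Implicit.
Unset Printing Implicit Defensive.

Import GRing.Theory.
Local Open Scope ring_scope.

(** * Monomials and homogeneous polynomials *)

Section Monomials.
Variables (R : comNzRingType) (n : nat).
Implicit Types (p q : {mpoly R[n]}) (u v : 'X_{1..n}).

Definition mfilter (P : pred 'X_{1..n}) p : {mpoly R[n]} :=
  \sum_(u <- msupp p | P u) p@_u *: 'X_[u].

Lemma mcoeff_filter P p u : (mfilter P p)@_u = if P u then p@_u else 0.
Proof.
rewrite raddf_sum /= (eq_bigr (fun w => if w == u then p@_u else 0)); last first.
  by move=> w _; rewrite mcoeffZ mcoeffX; case: eqP => [->|_];
    rewrite ?mulr1 ?mulr0.
rewrite -big_mkcondr /=; case: (boolP (u \in msupp p)) => [up|/memN_msupp_eq0 ->].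
  case: ifP => Pu; last first.
    by rewrite big1 // => w /andP[Pw /eqP wu]; rewrite -wu Pw in Pu.
  rewrite (big_rem u) //= Pu eqxx /= big_seq_cond big1 ?addr0 // => w.
  rewrite mem_rem_uniq ?msupp_uniq // inE => /andP[/andP[/negPf -> _]].
  by rewrite andbF.
by rewrite big1 // if_same.
Qed.

Lemma mcoeffXM v p u :
  ('X_[v] * p)@_u = if (v <= u)%MM then p@_(u - v)%MM else 0.
Proof.
rewrite mulrC; case: ifP => [vu|nvu]; first by rewrite -{1}(submK vu) addmC mcoeffMX.
apply/eqP; rewrite mcoeff_eq0; apply/negP.
rewrite (perm_mem (msuppMX _ _)) => /mapP[w _ uw].
by rewrite uw lem_addr in nvu.
Qed.

(** Division by a monomial, discarding the terms that it does not divide. *)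
Definition mdivX v p : {mpoly R[n]} :=
  \sum_(u <- msupp p | (v <= u)%MM) p@_u *: 'X_[(u - v)%MM].

Lemma mcoeff_divX v p u : (mdivX v p)@_u = p@_(u + v)%MM.
Proof.
have <- : ('X_[v] * mdivX v p)@_(u + v)%MM = (mdivX v p)@_u.
  by rewrite mcoeffXM lem_addl addmK.
have -> : 'X_[v] * mdivX v p = mfilter (fun w => (v <= w)%MM) p.
  rewrite mulr_sumr; apply: eq_bigr => w vw.
  by rewrite -scalerAr -mpolyXD addmC submK.
by rewrite mcoeff_filter lem_addl.
Qed.

Lemma mdivX_additive v : zmod_morphism (mdivX v).
Proof. by move=> p q; apply/mpolyP => u; rewrite mcoeffB !mcoeff_divX mcoeffB. Qed.
HB.instance Definition _ v :=
  GRing.isZmodMorphism.Build {mpoly R[n]} {mpoly R[n]} (mdivX v) (mdivX_additive v).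

Lemma mdivXK v p : mdivX v ('X_[v] * p) = p.
Proof. by apply/mpolyP => u; rewrite mcoeff_divX mcoeffXM lem_addl addmK. Qed.

Lemma mdvdX_divK v p : (forall u, p@_u != 0 -> (v <= u)%MM) ->
  p = 'X_[v] * mdivX v p.
Proof.
move=> h; apply/mpolyP => u; rewrite mcoeffXM mcoeff_divX.
case: ifP => [/submK ->//|vu]; apply/eqP; rewrite -[_ == _]negbK.
by apply/negP => /h; rewrite vu.
Qed.

Lemma mdvdX_supp v p q u : p = 'X_[v] * q -> p@_u != 0 -> (v <= u)%MM.
Proof. by move=> ->; rewrite mcoeffXM; case: ifP => //; rewrite eqxx. Qed.

Lemma mcoeff_sign a p u : ((-1) ^+ a * p)@_u = (-1) ^+ a * p@_u.
Proof. by rewrite -!(signr_odd _ a) !mulr_sign; case: odd; rewrite // mcoeffN. Qed.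

End Monomials.

Section PolyGrading.
Variables (k : fieldType) (n : nat) (D : zmodType).
Variable phi : {additive 'rV[int]_n -> D}.
Local Notation S := {mpoly k[n]}.
Local Notation degD := (Defs.mdegD phi).

Lemma degDD u v : degD (u + v)%MM = degD u + degD v.
Proof.
by rewrite /Defs.mdegD -big_split; apply: eq_bigr => i _; rewrite mnmDE mulrnDr.
Qed.

Lemma degDB u v : (v <= u)%MM -> degD (u - v)%MM = degD u - degD v.
Proof. by move=> vu; rewrite -{2}(submK vu) degDD addrK. Qed.

Lemma poly_gradingP d (p : S) :
  poly_grading phi d p <-> forall u, p@_u != 0 -> degD u = d.
Proof.
by split=> h u; [rewrite -mcoeff_msupp|rewrite mcoeff_msupp]; exact: h.
Qed.

Lemma poly_grading0 d : poly_grading phi d (0 : S).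
Proof. by apply/poly_gradingP => u; rewrite mcoeff0 eqxx. Qed.

Lemma poly_gradingX u : poly_grading phi (degD u) ('X_[u] : S).
Proof. by move=> v; rewrite msuppX inE => /eqP ->. Qed.

Lemma poly_gradingD d (p q : S) :
  poly_grading phi d p -> poly_grading phi d q -> poly_grading phi d (p + q).
Proof.
move=> hp hq u /msuppD_le; rewrite mem_cat => /orP[]; [exact: hp|exact: hq].
Qed.

Lemma poly_gradingM d e (p q : S) :
  poly_grading phi d p -> poly_grading phi e q -> poly_grading phi (d + e) (p * q).
Proof.
move=> hp hq u /msuppM_le/allpairsP[[v w] /= [/hp <- /hq <- ->]].
by rewrite degDD.
Qed.

Lemma poly_grading_sign a : poly_grading phi 0 ((-1) ^+ a : S).
Proof.
have h1 : poly_grading phi 0 (1 : S).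
  move=> u; rewrite msupp1 inE => /eqP ->.
  by rewrite /Defs.mdegD big1 // => i _; rewrite mnm0E.
elim: a => [|a IH]; rewrite ?expr0 // exprS -(addr0 0).
by apply: poly_gradingM => // u; rewrite (perm_mem (msuppN _)); exact: h1.
Qed.

End PolyGrading.

(** * Homogeneous components, graded free modules and graded chain maps *)

Lemma big_widen (V : nmodType) (I : eqType) (s t : seq I) (y : I -> V) :
    uniq s -> uniq t -> {subset s <= t} -> (forall i, i \notin s -> y i = 0) ->
  \sum_(i <- s) y i = \sum_(i <- t) y i.
Proof.
move=> us ut st y0; rewrite [RHS](bigID (mem s)) /= [X in _ + X]big1 ?addr0.
  rewrite -[RHS]big_filter; apply: perm_big; apply: uniq_perm => //.
    exact: filter_uniq.
  by move=> i; rewrite mem_filter /=; case: (boolP (i \in s)) => // /st ->.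
by move=> i; exact: y0.
Qed.

Lemma big_pick (V : nmodType) (I : eqType) (s : seq I) (j : I) (y : I -> V) :
  uniq s -> \sum_(i <- s) (if i == j then y i else 0) = if j \in s then y j else 0.
Proof.
move=> us; case: (boolP (j \in s)) => js.
  rewrite (bigD1_seq j) //= eqxx big1 ?addr0 // => i /negPf ->//.
rewrite big_seq big1 // => i si; case: eqP => // ij.
by rewrite -ij si in js.
Qed.

Section Pieces.
Variables (k : fieldType) (n : nat) (D : zmodType).
Variable phi : {additive 'rV[int]_n -> D}.
Local Notation S := {mpoly k[n]}.
Local Notation degD := (Defs.mdegD phi).

Section Def.
Variables (P : lmodType S) (Pg : D -> set P).

(** A relation, so that uniqueness ([pieces_uniq]) is available before components
    are chosen; the components are then computed by exhibiting a decomposition. *)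
Definition pieces (x : P) (y : D -> P) : Prop :=
  (forall d, Pg d (y d)) /\
  exists s : seq D, [/\ uniq s, forall d, d \notin s -> y d = 0 &
                        x = \sum_(d <- s) y d].

Hypothesis gP : is_graded phi Pg.

Lemma gr_opp d x : Pg d x -> Pg d (- x).
Proof.
move=> h; rewrite -scaleN1r -(add0r d); apply: (gr_act gP) => //.
exact: (@poly_grading_sign _ _ _ _ 1).
Qed.

Lemma pieces_exists x : exists y, pieces x y.
Proof.
have [s [y [yg ->]]] := gr_span gP x.
exists (fun d => y d *+ count_mem d s); split=> [d|].
  elim: (count_mem d s) => [|c IH]; first exact: (gr_zero gP).
  by rewrite mulrS; apply: (gr_add gP).
exists (undup s); split; first exact: undup_uniq.
  by move=> d; rewrite mem_undup => /count_memPn ->.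
exact/esym/(big_undup_iterop_count _ s xpredT y).
Qed.

Lemma piecesB x x' y y' :
  pieces x y -> pieces x' y' -> pieces (x - x') (fun d => y d - y' d).
Proof.
move=> [yg [s [us y0 ->]]] [y'g [s' [us' y'0 ->]]]; split=> [d|].
  by apply: (gr_add gP) => //; apply: gr_opp.
have ut := undup_uniq (s ++ s'); exists (undup (s ++ s')); split=> //.
  by move=> d; rewrite mem_undup mem_cat => /norP[/y0 -> /y'0 ->]; rewrite subr0.
rewrite sumrB; congr (_ - _); apply: big_widen => // d ds.
  by rewrite mem_undup mem_cat ds.
by rewrite mem_undup mem_cat ds orbT.
Qed.

Lemma pieces_uniq x y y' : pieces x y -> pieces x y' -> y = y'.
Proof.
move=> h h'; have [yg [s [us y0 e]]] := piecesB h h'; apply/funext => d.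
apply/eqP; rewrite -subr_eq0; apply/eqP; case: (boolP (d \in s)) => [|/y0//].
by apply: (gr_direct gP us yg); rewrite -e subrr.
Qed.

Definition hcomp d x : P := sval (cid (pieces_exists x)) d.

Lemma hcomp_pieces x : pieces x (hcomp^~ x).
Proof. exact: (svalP (cid (pieces_exists x))). Qed.

Lemma hcomp_homog d x : Pg d (hcomp d x).
Proof. exact: (hcomp_pieces x).1. Qed.

Lemma hcompE x y d : pieces x y -> hcomp d x = y d.
Proof. by move=> h; rewrite -(pieces_uniq (hcomp_pieces x) h). Qed.

Lemma hcomp_id d x : Pg d x -> hcomp d x = x.
Proof.
move=> h; rewrite (@hcompE x (fun e => if e == d then x else 0)) ?eqxx//.
split=> [e|]; first by case: eqP => [->//|_]; exact: (gr_zero gP).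
exists [:: d]; split=> // [e|]; first by rewrite inE => /negPf ->.
by rewrite big_seq1 eqxx.
Qed.

Lemma hcomp_additive d : zmod_morphism (hcomp d).
Proof.
by move=> x y; rewrite (hcompE _ (piecesB (hcomp_pieces x) (hcomp_pieces y))).
Qed.
HB.instance Definition _ d :=
  GRing.isZmodMorphism.Build P P (hcomp d) (hcomp_additive d).
End Def.

Section Map.
Variables (P Q : lmodType S) (Pg : D -> set P) (Qg : D -> set Q).
Hypotheses (gP : is_graded phi Pg) (gQ : is_graded phi Qg).

(** Applying a homogeneous map to a decomposition gives a decomposition, which is
    unique: hence homogeneous maps commute with taking components. *)
Lemma hcomp_map (h : {additive P -> Q}) a e x :
    (forall d y, Pg d y -> Qg (d + a) (h y)) ->
  hcomp gQ (e + a) (h x) = h (hcomp gP e x).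
Proof.
move=> hh; rewrite (@hcompE _ _ gQ (h x) (fun d => h (hcomp gP (d - a) x))).
  by rewrite addrK.
have [yg [s [us y0 ex]]] := hcomp_pieces gP x; split=> [d|].
  by rewrite -{1}(subrK a d); apply: hh.
exists (map (+%R^~ a) s); split.
- by rewrite map_inj_uniq //; exact: addIr.
- move=> d ds; rewrite y0 ?raddf0 //; apply: contra ds => ds.
  by apply/mapP; exists (d - a); rewrite ?subrK.
rewrite big_map {1}ex raddf_sum; apply: eq_bigr => d _.
by rewrite addrK.
Qed.

Lemma hcomp_lmap (h : lhom P Q) e x : homogeneous_map Pg Qg 0 h ->
  hcomp gQ e (h x) = h (hcomp gP e x).
Proof.
move=> hh; rewrite -{1}(addr0 e).
exact: (@hcomp_map (lhom_fun h) 0 e x hh).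
Qed.
End Map.

Lemma hcompZ (P : lmodType S) (Pg : D -> set P) (gP : is_graded phi Pg) a e
    (c : S) x : poly_grading phi a c ->
  hcomp gP (e + a) (c *: x) = c *: hcomp gP e x.
Proof.
move=> hc; apply: (@hcomp_map P P Pg Pg gP gP (GRing.scale c)) => d y hy /=.
by rewrite addrC; apply: (gr_act gP).
Qed.
End Pieces.

Section FreeCoord.
Variables (R : comNzRingType) (I : choiceType) (V : lmodType R) (b : I -> V).
Hypothesis bb : is_basis b.

Lemma basis_coord_exists : exists co : I -> lhom V R^o,
  forall e e', co e (b e') = (e' == e)%:R.
Proof.
have /choice[co coP] e : exists h : lhom V R^o, forall e', h (b e') = (e' == e)%:R.
  exact: basis_lhom.
by exists co.
Qed.
Definition basis_coord : I -> lhom V R^o := sval (cid basis_coord_exists).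

Lemma basis_coordE e e' : basis_coord e (b e') = (e' == e)%:R.
Proof. exact: (svalP (cid basis_coord_exists)). Qed.

Lemma basis_coord_sum e s (a : I -> R) :
  basis_coord e (\sum_(i <- s) a i *: b i) = \sum_(i <- s) (if i == e then a i else 0).
Proof.
rewrite linear_sum; apply: eq_bigr => i _; rewrite linearZ /= basis_coordE.
by case: eqP => _; [exact: mulr1|exact: mulr0].
Qed.

Lemma basis_coord_support x : exists s : seq I,
  [/\ uniq s, forall e, e \notin s -> basis_coord e x = 0 &
      x = \sum_(e <- s) basis_coord e x *: b e].
Proof.
have [s [c [us ->]]] := bb.1 x; exists s.
have E e : basis_coord e (\sum_(i <- s) c i *: b i) = if e \in s then c e else 0.
  by rewrite basis_coord_sum big_pick.
split=> // [e|]; first by rewrite E => /negPf ->.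
by apply: eq_big_seq => e es; rewrite E es.
Qed.

Lemma basis_coord_inj x y : (forall e, basis_coord e x = basis_coord e y) -> x = y.
Proof.
move=> h; apply/eqP; rewrite -subr_eq0; apply/eqP.
have [s [_ _ ->]] := basis_coord_support (x - y); apply: big1 => e _.
by rewrite linearB /= h subrr scale0r.
Qed.
End FreeCoord.

Section FreeGraded.
Variables (k : fieldType) (n : nat) (D : zmodType).
Variable phi : {additive 'rV[int]_n -> D}.
Local Notation S := {mpoly k[n]}.
Local Notation degD := (Defs.mdegD phi).
Variables (I : choiceType) (V : lmodType S) (b : I -> V) (deg : I -> D).
Hypothesis bb : is_basis b.
Local Notation Vg := (free_grading phi b deg).

(** Coordinates are unambiguous, whereas the combinations in [free_grading] may
    repeat basis elements. *)
Lemma free_gradingP d x :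
  Vg d x <-> forall e, poly_grading phi (d - deg e) (basis_coord bb e x : S).
Proof.
split=> [[s [c [hc ->]]] e|h]; last first.
  have [s [_ _ ex]] := basis_coord_support bb x.
  by exists s, (fun e => basis_coord bb e x).
rewrite basis_coord_sum big_seq.
apply: (big_ind (fun p : S => poly_grading phi (d - deg e) p)).
- exact: poly_grading0.
- by move=> p q; apply: poly_gradingD.
by move=> i /hc; case: eqP => [->|_ _] //; exact: poly_grading0.
Qed.

Lemma free_grading_gen e : Vg (deg e) (b e).
Proof.
apply/free_gradingP => e'; rewrite basis_coordE; case: eqP => [->|_].
  rewrite subrr; exact: (@poly_grading_sign _ _ _ _ 0).
exact: poly_grading0.
Qed.

Lemma free_is_graded : is_graded phi Vg.
Proof.
split.
- by move=> d; apply/free_gradingP => e; rewrite linear0; exact: poly_grading0.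
- move=> d x y /free_gradingP hx /free_gradingP hy; apply/free_gradingP => e.
  by rewrite linearD; exact: poly_gradingD.
- move=> d d' p x hp /free_gradingP hx; apply/free_gradingP => e.
  by rewrite linearZ -addrA; exact: poly_gradingM.
- move=> x; have [s [us x0 ex]] := basis_coord_support bb x.
  pose c e : S := basis_coord bb e x.
  pose t := undup [seq degD u + deg e | e <- s, u <- msupp (c e)].
  pose y d := \sum_(e <- s) mfilter (fun u => degD u + deg e == d) (c e) *: b e.
  exists t, y; split=> [d|].
    exists s, (fun e => mfilter (fun u => degD u + deg e == d) (c e)).
    split=> // e es; apply/poly_gradingP => u; rewrite mcoeff_filter.
    by case: (_ =P d) => [<- _|]; rewrite ?addrK ?eqxx.
  rewrite {1}ex /y exchange_big /=; apply: eq_big_seq => e es.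
  rewrite -scaler_suml; congr (_ *: _); apply/mpolyP => u.
  rewrite raddf_sum /=.
  under eq_bigr => d _ do rewrite mcoeff_filter eq_sym.
  rewrite (big_pick _ (fun=> (c e)@_u)) ?undup_uniq //.
  case: (boolP (_ \in t)) => // ut; apply/eqP; apply: contraNT ut => cu.
  rewrite mem_undup; apply/allpairsPdep; exists e, u; split=> //.
  by rewrite mcoeff_msupp.
- move=> s y us yg y0 d ds; apply: (@basis_coord_inj _ _ _ _ bb) => e; rewrite linear0.
  apply/mpolyP => u; rewrite mcoeff0.
  have /free_gradingP/(_ e)/poly_gradingP hd := yg d.
  apply/eqP; apply/negP => /negP cu.
  have : (basis_coord bb e (\sum_(i <- s) y i) : S)@_u = 0.
    by rewrite y0 linear0 mcoeff0.
  rewrite linear_sum raddf_sum /= (bigD1_seq d) //= big1 ?addr0.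
    by move/eqP; rewrite (negPf cu).
  move=> i /eqP id; have /free_gradingP/(_ e)/poly_gradingP hi := yg i.
  apply/eqP; apply/negP => /negP /hi; rewrite hd // => /addIr.
  by move=> /esym.
Qed.

(** The component of degree [a] of [h] is prescribed on the basis. Since it is given
    by the components of values of [h] on all homogeneous elements, it inherits the
    identities between [h] and homogeneous maps. *)
Lemma lhom_component (W : lmodType S) (Wg : D -> set W) (gW : is_graded phi Wg)
    (h : lhom V W) (a : D) :
  exists h' : lhom V W, forall e x, Vg e x -> h' x = hcomp gW (e + a) (h x).
Proof.
have [h' hP] := basis_lhom (fun i => hcomp gW (deg i + a) (h (b i))) bb.
exists h' => e x [s [c [hc ->]]]; rewrite !linear_sum [RHS]raddf_sum /=.
apply: eq_big_seq => i is_; rewrite !linearZ /= hP -(hcompZ _ _ _ (hc i is_)).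
by congr (hcomp _ _); rewrite addrAC addrCA subrr addr0.
Qed.

Lemma homogeneous_gens (W : lmodType S) (Wg : D -> set W)
    (gW : is_graded phi Wg) (h : lhom V W) (a : D) :
  (forall i, Wg (deg i + a) (h (b i))) -> homogeneous_map Vg Wg a h.
Proof.
move=> hW e x [s [c [hc ->]]]; rewrite linear_sum big_seq.
apply: big_ind => [|y z|i is_]; [exact: (gr_zero gW)|exact: (gr_add gW)|].
rewrite linearZ /= -(subrK (deg i) e) -addrA.
by apply: (gr_act gW); [exact: hc|exact: hW].
Qed.
End FreeGraded.

Section GradedChainMap.
Variables (k : fieldType) (n : nat) (D : zmodType).
Variable phi : {additive 'rV[int]_n -> D}.
Local Notation S := {mpoly k[n]}.
Variables (M N : lmodType S) (Mg : D -> set M) (Ng : D -> set N).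
Variables (G : graded_free_resolution phi Mg) (Q : graded_free_resolution phi Ng).
Hypothesis gN : is_graded phi Ng.
Variables (f : lhom M N) (hf : homogeneous_map Mg Ng 0 f).

Lemma gres_graded (M' : lmodType S) (M'g : D -> set M')
  (H : graded_free_resolution phi M'g) j : is_graded phi (gres_grading H j).
Proof. by apply: free_is_graded; exact: res_basis. Qed.

Lemma gres_ext (M' : lmodType S) (M'g : D -> set M')
    (H : graded_free_resolution phi M'g) j (W : lmodType S)
    (u v : lhom (H j) W) :
  (forall e x, gres_grading H j e x -> u x = v x) -> forall x, u x = v x.
Proof.
move=> uv x; have [s [c [_ ->]]] := (res_basis H j).1 x.
rewrite !linear_sum; apply: eq_bigr => i _; rewrite !linearZ /=.
congr (_ *: _).
exact: (uv _ _ (free_grading_gen phi (@gres_deg _ _ _ _ _ _ H j) (res_basis H j) i)).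
Qed.

(** Take the components of degree [0] of any lift: differentials and augmentations
    are homogeneous of degree [0], so the relations of a chain map survive. *)
Lemma graded_chain_map : exists c : chain_map G Q f,
  forall j, homogeneous_map (gres_grading G j) (gres_grading Q j) 0 (c j).
Proof.
have [c _] := chain_map_exists G Q f.
have c'_exists j : exists h : lhom (G j) (Q j),
    forall e x, gres_grading G j e x -> h x = hcomp (gres_graded Q j) (e + 0) (c j x).
  exact: (lhom_component (@gres_deg _ _ _ _ _ _ G j) (res_basis G j)).
pose c' j := sval (cid (c'_exists j)).
have c'P j : forall e x, gres_grading G j e x ->
    c' j x = hcomp (gres_graded Q j) (e + 0) (c j x).
  exact: (svalP (cid (c'_exists j))).
have c'g j : homogeneous_map (gres_grading G j) (gres_grading Q j) 0 (c' j).
  by move=> e x hx; rewrite (c'P _ e) //; exact: hcomp_homog.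
unshelve eexists.
  exists c'.
    apply: (@gres_ext _ _ G 0 _ (lhom_comp (res_aug Q) (c' 0))
              (lhom_comp f (res_aug G))) => e x hx /=.
    rewrite (c'P _ e) // -(hcomp_lmap _ gN) ?cm_aug.
      by apply: hcomp_id; apply: hf; rewrite -(addr0 e); exact: (gres_aug_homog hx).
    exact: gres_aug_homog.
  move=> j; apply: (@gres_ext _ _ G j.+1 _ (lhom_comp (res_d Q j) (c' j.+1))
            (lhom_comp (c' j) (res_d G j))) => e x hx /=.
  have hd : gres_grading G j e (res_d G j x).
    by rewrite -(addr0 e); exact: (gres_d_homog hx).
  rewrite (c'P _ e) // (c'P _ e) // -(hcomp_lmap _ (gres_graded Q j)) ?cm_d //.
  exact: gres_d_homog.
by [].
Qed.

Lemma Ext_map_graded (P : lmodType S) (Pg : D -> set P) i d x :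
  Ext_grading Q Pg i d x -> Ext_grading G Pg i d (Ext_map G Q f P i x).
Proof.
have [c cg] := graded_chain_map; move=> [z zg <-].
rewrite (Ext_mapE c) Ext_chain_mapE; exists (cocycle_pull c P i z) => //.
move=> e y hy /=; apply: zg; rewrite -(addr0 e); exact: cg.
Qed.
End GradedChainMap.

(** * Signs, least common multiples and the Taylor differential on cochains *)

Section Signs.
Variable r : nat.
Implicit Types (a b : 'I_r) (I : {set 'I_r}).

(** Its parity is the sign of the face [I :\ a] in the boundary of [I]. *)
Definition rank_in a I : nat := #|[set l in I | (l < a)%N]|.
Definition inc_sign (R : pzRingType) a I : R := (-1) ^+ rank_in a I.

Lemma rank_inD1 a b I : b \in I -> rank_in a I = ((b < a)%N + rank_in a (I :\ b))%N.
Proof.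
move=> bI; rewrite /rank_in (cardsD1 b) !inE bI /=; congr (_ + #|pred_of_set _|)%N.
by apply/setP => l; rewrite !inE andbA.
Qed.

Lemma inc_sign_self (R : pzRingType) a I : inc_sign R a (I :\ a) = inc_sign R a I.
Proof.
congr (_ ^+ #|pred_of_set _|); apply/setP => l; rewrite !inE.
by case: eqP => //= ->; rewrite ltnn andbF.
Qed.

Lemma inc_signK (R : pzRingType) a I : inc_sign R a I * inc_sign R a I = 1.
Proof. by rewrite -expr2 sqrr_sign. Qed.

Lemma inc_sign_swap (R : pzRingType) a b I : a \in I -> b \in I -> a != b ->
  inc_sign R a I * inc_sign R b (I :\ a) = - (inc_sign R b I * inc_sign R a (I :\ b)).
Proof.
move=> aI bI ab; rewrite /inc_sign (rank_inD1 a bI) (rank_inD1 b aI) !exprD.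
have : (a < b)%N || (b < a)%N by rewrite -neq_ltn.
case: ltngtP => //= _ _; rewrite expr0 expr1 !mul1r mulN1r !mulNr ?opprK;
  by rewrite -!exprD addnC.
Qed.

(** The cancellation behind the vanishing of squared differentials. The pairs are
    split by order instead of showing that the sum is its own opposite, which would
    not suffice in characteristic 2. *)
Lemma antisym_sum (V : zmodType) (A : {set 'I_r}) (F : 'I_r -> 'I_r -> V) :
    (forall a b, a \in A -> b \in A -> a != b -> F a b = - F b a) ->
  \sum_(a in A) \sum_(b in A :\ a) F a b = 0.
Proof.
move=> anti.
have -> : \sum_(a in A) \sum_(b in A :\ a) F a b =
    \sum_(a in A) \sum_(b in A | (a < b)%N) F a b +
    \sum_(a in A) \sum_(b in A | (b < a)%N) F a b.
  rewrite -big_split; apply: eq_bigr => a aA /=.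
  rewrite (bigID (fun b => (a < b)%N)) /=; congr (_ + _); apply: eq_bigl => b;
    rewrite !inE.
    by rewrite -val_eqE /=; case: ltngtP; rewrite ?andbT ?andbF.
  by rewrite -val_eqE /=; case: ltngtP; rewrite ?andbT ?andbF.
rewrite [X in _ + X](exchange_big_dep (fun b => b \in A)) /=; last by move=> a b _ /andP[].
rewrite -big_split big1 // => a aA /=.
apply/eqP; rewrite addr_eq0 -sumrN; apply/eqP; rewrite aA; apply: eq_bigr => b /andP[bA ab].
by apply: anti => //; rewrite -val_eqE /= neq_ltn ab.
Qed.
End Signs.

Section Lcm.
Variables (n r : nat) (g : 'I_r -> 'X_{1..n}).

Definition mlcms (I : {set 'I_r}) : 'X_{1..n} := [multinom \max_(j in I) g j i | i < n].

Lemma mlcmsP (I : {set 'I_r}) u :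
  (mlcms I <= u)%MM <-> (forall j, j \in I -> (g j <= u)%MM).
Proof.
split=> [/mnm_lepP h j jI|h]; apply/mnm_lepP => i.
  apply: leq_trans (h i); rewrite mnmE.
  exact: (@leq_bigmax_cond _ (mem I) (fun j => g j i) j jI).
by rewrite mnmE; apply/bigmax_leqP => j /h/mnm_lepP.
Qed.

Lemma mlcms_sub (I J : {set 'I_r}) : I \subset J -> (mlcms I <= mlcms J)%MM.
Proof.
move=> /fintype.subsetP IJ; apply/mlcmsP => j /IJ jJ; exact: (mlcmsP J (mlcms J)).1 (lepm_refl _) j jJ.
Qed.
End Lcm.

Section Cochains.
Variables (k : fieldType) (n r : nat) (g : 'I_r -> 'X_{1..n}).
Local Notation S := {mpoly k[n]}.
Local Notation W := (mlcms g).

(** The coefficient of the face [I :\ a] in the boundary of the face [I] of the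
    Taylor complex. *)
Definition taylor_coef (I : {set 'I_r}) a : S :=
  inc_sign S a I * 'X_[(W I - W (I :\ a))%MM].

Lemma taylor_coef_swap (I : {set 'I_r}) a b : a \in I -> b \in I -> a != b ->
  taylor_coef I a * taylor_coef (I :\ a) b = - (taylor_coef I b * taylor_coef (I :\ b) a).
Proof.
move=> aI bI ab.
have E x y : x \in I -> y \in I ->
    taylor_coef I x * taylor_coef (I :\ x) y = inc_sign S x I * inc_sign S y (I :\ x) *
      'X_[(W I - W (I :\: [set x; y]))%MM].
  move=> xI yI; rewrite /taylor_coef mulrACA -mpolyXD; congr (_ * 'X_[_]).
  have -> : I :\: [set x; y] = (I :\ x) :\ y by rewrite finset.setDDl.
  have h1 := mlcms_sub g (finset.subsetDl I [set x]).
  have h2 := mlcms_sub g (finset.subsetDl (I :\ x) [set y]).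
  apply/mnmP => i; move/mnm_lepP/(_ i): h1; move/mnm_lepP/(_ i): h2.
  rewrite !mnmDE !mnmBE => h2 h1; rewrite addnBA // subnK //.
rewrite E // E // inc_sign_swap // mulNr; congr (- (_ * 'X_[W I - W (I :\: _)])).
by rewrite finset.setUC.
Qed.

Section Delta.
Variable X : lmodType S.
Implicit Types c : {set 'I_r} -> X.

(** The differential of [Hom(T, X)], for the Taylor resolution [T] on the
    monomials [g]: a cochain lists the values on the basis of [T]. *)
Definition delta c (I : {set 'I_r}) : X :=
  \sum_(a in I) taylor_coef I a *: c (I :\ a).

Lemma delta_additive : zmod_morphism delta.
Proof.
move=> c c'; apply/funext => I; rewrite /delta -[RHS]/(_ - _) -sumrB.
by apply: eq_bigr => a _; rewrite -scalerBr.
Qed.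
HB.instance Definition _ :=
  GRing.isZmodMorphism.Build ({set 'I_r} -> X) ({set 'I_r} -> X) delta delta_additive.

Lemma deltaK c : delta (delta c) = 0.
Proof.
apply/funext => I; rewrite [RHS]/(0 I) /delta.
under eq_bigr => a _ do rewrite scaler_sumr.
apply: (antisym_sum (F := fun a b => taylor_coef I a *: (taylor_coef (I :\ a) b *: c ((I :\ a) :\ b)))).
move=> a b aI bI ab; rewrite !scalerA taylor_coef_swap // scaleNr.
by rewrite !finset.setDDl [[set a] :|: _]finset.setUC.
Qed.
End Delta.

Lemma delta_map (X Y : lmodType S) (h : lhom X Y) (c : {set 'I_r} -> X) I :
  delta (fun J => h (c J)) I = h (delta c I).
Proof. by rewrite linear_sum; apply: eq_bigr => a _; rewrite linearZ. Qed.

End Cochains.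

(** * The Taylor complex and its contraction *)

Section TaylorModules.
Variables (k : fieldType) (n r : nat) (g : 'I_r -> 'X_{1..n}).
Local Notation S := {mpoly k[n]}.
Local Notation W := (mlcms g).
Local Notation simplicial := {ffun {set 'I_r} -> S^o}.

Lemma mcoeff_inc_sign a (I : {set 'I_r}) (p : S) u :
  (inc_sign S a I * p)@_u = inc_sign k a I * p@_u.
Proof. exact: mcoeff_sign. Qed.

(** The Taylor complex is realised inside the chains of the full simplex with
    coefficients in [S]: the basis element of the face [I] becomes the multiple
    [X^(W I)] of that face. Its differential then has coefficients 1 and -1, and
    divisibility is the only condition that depends on the monomials [g]. *)
Definition taylor_pred (p : nat) : {pred simplicial} := fun t =>
  `[< forall I : {set 'I_r}, (exists q : S, t I = 'X_[W I] * q) /\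
                             (#|I| != p -> t I = 0) >].

Lemma taylor_pred_closed p : submod_closed (taylor_pred p).
Proof.
split=> [|a t t' /asboolP h /asboolP h']; apply/asboolP => I.
  by split=> [|_]; rewrite ffunE //; exists 0; rewrite mulr0.
have [[q e] z] := h I; have [[q' e'] z'] := h' I; split=> [|Ip].
  exists (a * q + q'); rewrite !ffunE e e' mulrDr; congr (_ + _).
  by rewrite mulrCA.
by rewrite !ffunE z // z' // scaler0 addr0.
Qed.
HB.instance Definition _ p :=
  GRing.isSubmodClosed.Build S simplicial (taylor_pred p) (taylor_pred_closed p).

Record taylor p := Taylor { taylor_val :> simplicial; _ : taylor_val \in taylor_pred p }.
HB.instance Definition _ p := [isSub for @taylor_val p].
HB.instance Definition _ p := [Choice of taylor p by <:].
HB.instance Definition _ p := [SubChoice_isSubLmodule of taylor p by <:].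

Definition taylor_at p (t : taylor p) (I : {set 'I_r}) : S := taylor_val t I.

Lemma taylor_dvd p (t : taylor p) I : exists q : S, taylor_at t I = 'X_[W I] * q.
Proof. by have /asboolP/(_ I)[] := valP t. Qed.

Lemma taylor_supp p (t : taylor p) (I : {set 'I_r}) : #|I| != p -> taylor_at t I = 0.
Proof. by have /asboolP/(_ I)[] := valP t. Qed.

Lemma taylorP p (t t' : taylor p) :
  (forall I : {set 'I_r}, #|I| = p -> taylor_at t I = taylor_at t' I) -> t = t'.
Proof.
move=> h; apply/val_inj/ffunP => I.
rewrite -[LHS]/(taylor_at t I) -[RHS]/(taylor_at t' I).
by case: (#|I| =P p) => [/h//|/eqP Ip]; rewrite !taylor_supp.
Qed.

Lemma taylorZE p a (t : taylor p) I : taylor_at (a *: t) I = a * taylor_at t I.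
Proof. by rewrite [LHS]ffunE. Qed.

Lemma taylorDE p (t t' : taylor p) I :
  taylor_at (t + t') I = taylor_at t I + taylor_at t' I.
Proof. exact: ffunE. Qed.

Lemma taylor0E p I : taylor_at (0 : taylor p) I = 0.
Proof. exact: ffunE. Qed.

Lemma taylor_sumE p (T : Type) (s : seq T) (P : pred T) (F : T -> taylor p) I :
  taylor_at (\sum_(i <- s | P i) F i) I = \sum_(i <- s | P i) taylor_at (F i) I.
Proof.
exact: (big_morph (fun t => taylor_at t I) (fun t t' => taylorDE t t' I) (taylor0E p I)).
Qed.

Fact taylor_d_subproof p (t : taylor p.+1) :
  [ffun I : {set 'I_r} =>
     \sum_(a | a \notin I) inc_sign S a (a |: I) * taylor_at t (a |: I) : S^o]
    \in taylor_pred p.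
Proof.
apply/asboolP => I; split.
  rewrite ffunE; apply: (big_ind (fun x : S => exists q : S, x = 'X_[W I] * q)).
  - by exists 0; rewrite mulr0.
  - by move=> _ _ [q ->] [q' ->]; exists (q + q'); rewrite mulrDr.
  move=> a aI; have [q ->] := taylor_dvd t (a |: I).
  have h : (W I <= W (a |: I))%MM by apply/mlcms_sub/finset.subsetUr.
  exists (inc_sign S a (a |: I) * 'X_[(W (a |: I) - W I)%MM] * q).
  rewrite -[in LHS](submK h) mpolyXD.
  by rewrite !mulrA; congr (_ * _); rewrite mulrC !mulrA.
move=> Ip; rewrite ffunE big1 // => a aI.
by rewrite taylor_supp ?mulr0 // cardsU1 aI add1n eqSS.
Qed.
Definition taylor_d_fun p (t : taylor p.+1) : taylor p := Taylor (taylor_d_subproof t).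

Lemma taylor_d_funE p (t : taylor p.+1) I : taylor_at (taylor_d_fun t) I =
  \sum_(a | a \notin I) inc_sign S a (a |: I) * taylor_at t (a |: I).
Proof. exact: ffunE. Qed.

Fact taylor_d_linear p : linear (@taylor_d_fun p).
Proof.
move=> a t t'; apply: taylorP => I _; rewrite taylorDE taylorZE !taylor_d_funE.
rewrite mulr_sumr -big_split; apply: eq_bigr => i _.
by rewrite taylorDE taylorZE mulrDr mulrCA.
Qed.
Definition taylor_d p : lhom (taylor p.+1) (taylor p) := mk_lhom (@taylor_d_linear p).

Lemma taylor_dE p (t : taylor p.+1) I : taylor_at (taylor_d p t) I =
  \sum_(a | a \notin I) inc_sign S a (a |: I) * taylor_at t (a |: I).
Proof. exact: taylor_d_funE. Qed.

Fact taylor_gen_subproof p (I : {set 'I_r}) :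
  [ffun J : {set 'I_r} => if (J == I) && (#|J| == p) then 'X_[W I] : S^o else 0]
    \in taylor_pred p.
Proof.
apply/asboolP => J; rewrite ffunE; split=> [|/negPf ->]; last by rewrite andbF.
case: ifP => [/andP[/eqP -> _]|_]; first by exists 1; rewrite mulr1.
by exists 0; rewrite mulr0.
Qed.
(** Defined for every [I], with value [0] unless [I] has [p] elements, so that
    cochains can be functions on all sets. *)
Definition taylor_gen p I : taylor p := Taylor (taylor_gen_subproof p I).

Lemma taylor_genE p I J : taylor_at (taylor_gen p I) J =
  if (J == I) && (#|J| == p) then 'X_[W I] else 0.
Proof. exact: ffunE. Qed.

Lemma taylor_gen_supp p (I : {set 'I_r}) : #|I| != p -> taylor_gen p I = 0.
Proof.
move=> Ip; apply: taylorP => J Jp; rewrite taylor_genE taylor0E.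
by case: eqP => // JI; rewrite -JI Jp eqxx in Ip.
Qed.

Local Notation face p := {I : {set 'I_r} | #|I| == p}.

Lemma taylor_span p (t : taylor p) :
  t = \sum_(i : face p) mdivX (W (val i)) (taylor_at t (val i)) *: taylor_gen p (val i).
Proof.
apply: taylorP => I Ip; rewrite taylor_sumE.
have pI : #|I| == p by rewrite Ip.
rewrite (big_only1 (Sub I pI : face p)) ?SubK // => [|i].
  rewrite taylorZE taylor_genE eqxx pI.
  by have [q ->] := taylor_dvd t I; rewrite mdivXK mulrC.
rewrite -val_eqE SubK => /negPf iI.
by rewrite taylorZE taylor_genE eq_sym iI /= mulr0.
Qed.

Lemma taylor_basis p : is_basis (fun i : face p => taylor_gen p (val i)).
Proof.
split=> [t|s c us s0 i is_].
  exists (enum {: face p}), (fun i => mdivX (W (val i)) (taylor_at t (val i))).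
  by split; [exact: enum_uniq|rewrite big_enum {1}(taylor_span t)].
have : taylor_at (\sum_(i <- s) c i *: taylor_gen p (val i)) (val i) = 0.
  by rewrite s0 taylor0E.
rewrite taylor_sumE (eq_bigr (fun j => if j == i then c j * 'X_[W (val j)] else 0)).
  by rewrite big_pick // is_ mulrC => /(congr1 (mdivX (W (val i)))); rewrite mdivXK raddf0.
move=> j _; rewrite taylorZE taylor_genE (inj_eq val_inj) (eqP (valP i)) eqxx andbT eq_sym.
by case: eqP => // _; rewrite mulr0.
Qed.

Lemma taylor_ext (X : lmodType S) p (u v : lhom (taylor p) X) :
  (forall I, u (taylor_gen p I) = v (taylor_gen p I)) -> u = v.
Proof.
move=> uv; apply/lhomP => t; rewrite (taylor_span t) !linear_sum.
by apply: eq_bigr => i _; rewrite !linearZ /= uv.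
Qed.

Lemma taylor_lhom (X : lmodType S) p (c : {set 'I_r} -> X) :
    (forall I : {set 'I_r}, #|I| != p -> c I = 0) ->
  exists h : lhom (taylor p) X, forall I, h (taylor_gen p I) = c I.
Proof.
move=> c0; have [h hP] := basis_lhom (fun i => c (val i)) (taylor_basis p).
exists h => I; have [pI|pI] := boolP (#|I| == p); first exact: (hP (Sub I pI)).
by rewrite taylor_gen_supp // linear0 c0.
Qed.

Lemma taylor_d_gen p I :
  taylor_d p (taylor_gen p.+1 I) = delta g (taylor_gen p) I.
Proof.
apply: taylorP => J Jp; rewrite taylor_dE /delta taylor_sumE.
rewrite big_mkcond [RHS]big_mkcond /=; apply: eq_bigr => a _.
rewrite taylorZE !taylor_genE Jp eqxx andbT.
case: (boolP (a \in I)) => aI; last first.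
  case: ifP => // aJ; case: eqP => [JI|]; rewrite ?mulr0 //=.
  by rewrite -JI setU11 in aI.
case: (boolP (a \in J)) => aJ /=.
  case: eqP => JI; rewrite ?mulr0 //.
  by rewrite JI !inE eqxx in aJ.
rewrite cardsU1 aJ add1n Jp eqxx andbT.
have -> : (a |: J == I) = (J == I :\ a).
  by apply/eqP/eqP => [<-|->]; rewrite ?finset.setU1K ?finset.setD1K.
case: eqP => JI; rewrite ?mulr0 // -JI /taylor_coef -JI.
have aJI : a |: J = I by rewrite JI finset.setD1K.
rewrite aJI -mulrA -mpolyXD submK // JI.
exact/mlcms_sub/finset.subsetDl.
Qed.

(** The basis elements form a cochain with values in the Taylor complex itself,
    whose coboundary is its boundary ([taylor_d_gen]): so [deltaK] applies. *)
Lemma taylor_dd p (t : taylor p.+2) : taylor_d p (taylor_d p.+1 t) = 0.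
Proof.
pose dd : lhom (taylor p.+2) (taylor p) := lhom_comp (taylor_d p) (taylor_d p.+1).
suff e : dd = 0 by rewrite -[LHS]/(dd t) e lhom0.
apply: taylor_ext => I; rewrite lhom0.
rewrite -[LHS]/(taylor_d p (taylor_d p.+1 (taylor_gen p.+2 I))) taylor_d_gen -delta_map.
have -> : (fun J => taylor_d p (taylor_gen p.+1 J)) = delta g (taylor_gen p).
  by apply/funext => J; exact: taylor_d_gen.
by rewrite deltaK.
Qed.

(** Exactness: in the degree of a monomial [u] the complex is the augmented
    simplicial complex of the simplex on the [j] such that [g j] divides [u],
    and the cone on one of its vertices [apex u] contracts it. *)
Definition apex (u : 'X_{1..n}) : option 'I_r := [pick j | (g j <= u)%MM].

Definition cone p (t : taylor p) (I : {set 'I_r}) : S :=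
  \sum_(j in I) inc_sign S j (I :\ j) *
     mfilter (fun u => apex u == Some j) (taylor_at t (I :\ j)).

Lemma mcoeff_cone p (t : taylor p) (I : {set 'I_r}) u : (cone t I)@_u =
  if apex u is Some j then
    if j \in I then inc_sign k j (I :\ j) * (taylor_at t (I :\ j))@_u else 0
  else 0.
Proof.
rewrite raddf_sum /=.
under eq_bigr => j _ do rewrite mcoeff_inc_sign mcoeff_filter.
case: (apex u) => [j|]; last by rewrite big1 // => j _; rewrite mulr0.
case: ifP => jI; last first.
  rewrite big1 // => i iI; case: eqP => [[ji]|_]; last by rewrite mulr0.
  by rewrite ji iI in jI.
rewrite (bigD1 j) //= eqxx big1 ?addr0 // => i /andP[_ ij].
case: eqP => [[ji]|_]; last by rewrite mulr0.
by rewrite ji eqxx in ij.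
Qed.

Lemma apex_dvd u j : apex u = Some j -> (g j <= u)%MM.
Proof. by rewrite /apex; case: pickP => // i h [<-]. Qed.

Fact cone_subproof p (t : taylor p) :
  [ffun I : {set 'I_r} => cone t I : S^o] \in taylor_pred p.+1.
Proof.
apply/asboolP => I; split=> [|Ip].
  rewrite ffunE; exists (mdivX (W I) (cone t I)); apply: mdvdX_divK => u.
  rewrite mcoeff_cone; case ju: (apex u) => [j|]; last by rewrite eqxx.
  case: ifP => jI; last by rewrite eqxx.
  have [q e] := taylor_dvd t (I :\ j).
  rewrite mulf_eq0 => /norP[_ /(mdvdX_supp e)/mlcmsP h].
  apply/mlcmsP => i iI; case: (i =P j) => [->|/eqP ij]; first exact: apex_dvd.
  by apply: h; rewrite !inE ij.
rewrite ffunE /cone big1 // => j jI; rewrite taylor_supp.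
  by apply/mpolyP => u; rewrite mcoeff_inc_sign mcoeff_filter mcoeff0 if_same mulr0.
by move: Ip; rewrite (cardsD1 j) jI add1n eqSS.
Qed.
Definition taylor_cone p (t : taylor p) : taylor p.+1 := Taylor (cone_subproof t).

Lemma taylor_coneE p (t : taylor p) I : taylor_at (taylor_cone t) I = cone t I.
Proof. exact: ffunE. Qed.

(** Compare coefficients of a monomial [u] with apex [j]. If [j] is not in [I], only
    the face [j |: I] contributes, and the sign appears twice. If [j] is in [I], the
    faces [a |: I] contribute what is left of the vanishing boundary of [t] at
    [I :\ j] once the term of [I] is moved to the other side. *)
Lemma taylor_contract p (t : taylor p) :
    (forall u I, (taylor_at t I)@_u != 0 -> exists j, (g j <= u)%MM) ->
    (forall I : {set 'I_r},
       \sum_(a | a \notin I) inc_sign S a (a |: I) * taylor_at t (a |: I) = 0) ->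
  taylor_d p (taylor_cone t) = t.
Proof.
move=> hu t0; apply: taylorP => I _; rewrite taylor_dE; apply/mpolyP => u.
rewrite raddf_sum /=.
have bd0 (J : {set 'I_r}) :
    \sum_(a | a \notin J) inc_sign k a (a |: J) * (taylor_at t (a |: J))@_u = 0.
  have := congr1 (mcoeff u) (t0 J); rewrite mcoeff0 raddf_sum /= => e0.
  rewrite -[RHS]e0; apply: eq_bigr => a _.
  by rewrite mcoeff_inc_sign.
under eq_bigr => a _ do rewrite mcoeff_inc_sign taylor_coneE mcoeff_cone.
case ju: (apex u) => [j|]; last first.
  rewrite big1 => [|a _]; last by rewrite mulr0.
  apply/esym/eqP; apply/negP => /negP /hu[j gj].
  by move: ju; rewrite /apex; case: pickP => // /(_ j); rewrite gj.
case: (boolP (j \in I)) => jI; last first.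
  rewrite (bigD1 j) //= setU11 big1 ?addr0 => [|a /andP[aI aj]].
    by rewrite -(inc_sign_self _ j (j |: I)) finset.setU1K // mulrA inc_signK mul1r.
  by rewrite !inE eq_sym (negPf aj) (negPf jI) mulr0.
(* The term of [a = j] in the boundary of [t] at [I :\ j] is the one of [I]. *)
have bdj := bd0 (I :\ j).
rewrite (bigD1 j) /= in bdj; last by rewrite !inE eqxx.
rewrite finset.setD1K // in bdj.
have -> : (taylor_at t I)@_u = - (inc_sign k j I * \sum_(a | (a \notin I :\ j) && (a != j))
    inc_sign k a (a |: I :\ j) * (taylor_at t (a |: I :\ j))@_u).
  move/eqP: bdj; rewrite addrC addr_eq0 => /eqP ->.
  by rewrite mulrN opprK mulrA inc_signK mul1r.
rewrite -mulrN -sumrN mulr_sumr; apply: eq_big => [a|a aI].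
  by rewrite !inE; case: (a =P j) => [->|_]; rewrite ?jI //= andbT.
have aj : a != j by apply: contraNneq aI => ->.
have aIj : (a |: I) :\ j = a |: I :\ j.
  apply/setP => l; rewrite !inE; case: (l =P j) => //= ->.
  by rewrite orbF eq_sym (negPf aj).
have jaI : j \in a |: I by rewrite !inE jI orbT.
have := inc_sign_swap k (setU11 a I) jaI aj.
rewrite finset.setU1K // jaI aIj => e.
have {}e : inc_sign k a (a |: I) =
    - (inc_sign k j (a |: I) * inc_sign k a (a |: I :\ j) * inc_sign k j I).
  by rewrite -mulNr -e -mulrA inc_signK mulr1.
have -> : inc_sign k j (a |: I :\ j) = inc_sign k j (a |: I).
  by rewrite -aIj inc_sign_self.
rewrite e mulrN mulNr; congr (- _).
set x := inc_sign k j (a |: I); set y := inc_sign k a _; set z := inc_sign k j I.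
by rewrite mulrA (mulrAC _ z) (mulrAC _ y) inc_signK mul1r (mulrC y) -mulrA.
Qed.

End TaylorModules.

(** * The Taylor resolution of a monomial quotient *)

Section QuotientGraded.
Variables (k : fieldType) (n : nat) (D : zmodType).
Variable phi : {additive 'rV[int]_n -> D}.
Local Notation S := {mpoly k[n]}.
Local Notation degD := (Defs.mdegD phi).
Variables (N : submodClosed S^o) (Q : 'X_{1..n} -> Prop).
Hypothesis NQ : forall p : S, (p : S^o) \in N <-> (forall u, p@_u != 0 -> Q u).

(** A submodule cut out by a condition on the monomials that occur is homogeneous
    for every grading by monomials. *)
Lemma quotient_is_graded : is_graded phi (@quotient_grading k n D phi N).
Proof.
split.
- by move=> d; exists 0; [exact: poly_grading0|exact: linear0].
- move=> d _ _ [p hp <-] [q hq <-]; exists (p + q); first exact: poly_gradingD.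
  exact: linearD.
- move=> d e p _ hp [q hq <-]; exists (p *: q); first exact: poly_gradingM.
  exact: linearZ.
- elim/quotmod_ind => p.
  exists (undup (map degD (msupp (p : S)))).
  exists (fun d => quotmod_pi N (mfilter (fun u => degD u == d) p)); split.
    move=> d; exists (mfilter (fun u => degD u == d) p) => //.
    by apply/poly_gradingP => u; rewrite mcoeff_filter; case: (_ =P d) => // _ /eqP.
  rewrite -linear_sum; congr (quotmod_pi N _); apply/mpolyP => u.
  rewrite raddf_sum /=.
  under eq_bigr => d _ do rewrite mcoeff_filter eq_sym.
  rewrite (big_pick _ (fun=> (p : S)@_u)) ?undup_uniq //.
  case: ifP => // /negP uN; apply/eqP/negP => /negP pu; apply: uN.
  by rewrite mem_undup map_f // mcoeff_msupp.
move=> s y us yg y0 d ds.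
have /choice[p pP] e : exists q : S^o, poly_grading phi e q /\ quotmod_pi N q = y e.
  by have [q hq e'] := yg e; exists q.
have : \sum_(e <- s) p e \in N.
  rewrite -[X in X \in _]subr0; apply/quotmod_eq.
  by rewrite linear_sum linear0 -[RHS]y0; apply: eq_bigr => e _; case: (pP e).
move=> /NQ h; case: (pP d) => /poly_gradingP gd <-.
rewrite -(linear0 (quotmod_pi N)); apply/quotmod_eq; rewrite subr0.
apply/NQ => u pu; apply: h; rewrite raddf_sum /= (bigD1_seq d) //= big1 ?addr0 //.
move=> e /eqP ed; apply/eqP/negP => /negP pe; apply: ed.
by case: (pP e) => /poly_gradingP/(_ _ pe) <- _; rewrite gd.
Qed.
End QuotientGraded.

Lemma taylor_coef_homog (k : fieldType) (n r : nat) (g : 'I_r -> 'X_{1..n})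
    (D : zmodType) (phi : {additive 'rV[int]_n -> D}) (I : {set 'I_r}) a :
  poly_grading phi (Defs.mdegD phi (mlcms g I) - Defs.mdegD phi (mlcms g (I :\ a)))
    (taylor_coef k g I a).
Proof.
rewrite -degDB; last exact/mlcms_sub/finset.subsetDl.
rewrite -[X in poly_grading _ X](add0r _); apply: poly_gradingM.
  exact: poly_grading_sign.
exact: poly_gradingX.
Qed.

Section TaylorResolution.
Variables (k : fieldType) (n r : nat) (g : 'I_r -> 'X_{1..n}).
Local Notation S := {mpoly k[n]}.
Local Notation W := (mlcms g).
Variable N : submodClosed S^o.
Hypothesis NP : forall p : S,
  (p : S^o) \in N <-> (forall u, p@_u != 0 -> exists j, (g j <= u)%MM).
Local Notation T := (taylor k g).

Lemma mlcms0 : W finset.set0 = 0%MM.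
Proof. by apply/mnmP => i; rewrite mnmE big_set0 mnm0E. Qed.

Fact taylor_aug_linear : linear (fun t : T 0 => quotmod_pi N (taylor_at t finset.set0)).
Proof.
by move=> a t t'; rewrite taylorDE taylorZE; exact: (linearP (quotmod_pi N)).
Qed.
Definition taylor_aug : lhom (T 0) (quotmod N) := mk_lhom taylor_aug_linear.

Lemma taylor_augE t : taylor_aug t = quotmod_pi N (taylor_at t finset.set0).
Proof. by []. Qed.

Lemma taylor_aug_eq0 t : taylor_aug t = 0 <-> (taylor_at t finset.set0 : S^o) \in N.
Proof.
rewrite taylor_augE -(linear0 (quotmod_pi N)) -[X in X \in _]subr0.
exact: quotmod_eq.
Qed.

Fact taylor_aug_surj x : exists y, taylor_aug y = x.
Proof.
elim/quotmod_ind: x => p; exists ((p : S) *: taylor_gen k g 0 finset.set0).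
rewrite taylor_augE taylorZE taylor_genE eqxx cards0 eqxx mlcms0 mpolyX0.
by rewrite mulr1.
Qed.

Fact taylor_exact0 x : taylor_aug x = 0 <-> exists y, taylor_d k g 0 y = x.
Proof.
rewrite taylor_aug_eq0; split=> [h|[y <-]].
  exists (taylor_cone x); apply: taylor_contract => [u I|I].
    case: (I =P finset.set0) => [-> xu|/eqP I0]; first by move/NP: h; apply.
    by rewrite taylor_supp ?mcoeff0 ?eqxx // cards_eq0.
  rewrite big1 // => a aI; rewrite taylor_supp ?mulr0 //.
  by rewrite cardsU1 aI.
rewrite taylor_dE; apply: (big_ind (fun p : S => (p : S^o) \in N)).
- exact: (rpred0 N).
- by move=> p q; exact: (@rpredD _ N).
move=> a _; apply/NP => u.
rewrite mcoeff_inc_sign mulf_eq0 => /norP[_].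
have [q e] := taylor_dvd y (a |: finset.set0); move=> /(mdvdX_supp e)/mlcmsP h.
by exists a; apply: h; rewrite !inE eqxx.
Qed.

Fact taylor_exact p x :
  taylor_d k g p x = 0 <-> exists y, taylor_d k g p.+1 y = x.
Proof.
split=> [h|[y <-]]; last exact: taylor_dd.
exists (taylor_cone x); apply: taylor_contract => [u I|I].
  have [q e] := taylor_dvd x I => xu; have /mlcmsP hI := mdvdX_supp e xu.
  have : I != finset.set0.
    apply/negP => /eqP I0; move: xu; rewrite taylor_supp ?mcoeff0 ?eqxx //.
    by rewrite I0 cards0.
  by case/finset.set0Pn => a /hI ga; exists a.
by rewrite -taylor_dE h taylor0E.
Qed.

Definition taylor_res : free_resolution (quotmod N) :=
  FreeResolution (taylor_basis k g) taylor_aug_surj taylor_exact0 taylor_exact.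

Section Graded.
Variables (D : zmodType) (phi : {additive 'rV[int]_n -> D}).
Local Notation degD := (Defs.mdegD phi).

Definition taylor_deg j (i : res_idx taylor_res j) : D := degD (W (val i)).

Local Notation Tg j := (free_grading phi (@res_gen _ _ taylor_res j) (@taylor_deg j)).

Lemma taylor_res_graded j : is_graded phi (Tg j).
Proof. exact: free_is_graded (res_basis taylor_res j). Qed.

Lemma taylor_gen_homog j I : Tg j (degD (W I)) (taylor_gen k g j I).
Proof.
have [Ij|Ij] := boolP (#|I| == j); last first.
  by rewrite taylor_gen_supp //; exact: (gr_zero (taylor_res_graded j)).
exact: (free_grading_gen phi (@taylor_deg j) (res_basis taylor_res j) (Sub I Ij)).
Qed.

Lemma taylor_d_homog j : homogeneous_map (Tg j.+1) (Tg j) 0 (taylor_d k g j).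
Proof.
apply: (homogeneous_gens (taylor_res_graded j)) => i.
rewrite addr0 [X in Tg j _ X]taylor_d_gen /delta.
apply: (big_ind (Tg j _)) => [|x y|a _].
- exact: (gr_zero (taylor_res_graded j)).
- exact: (gr_add (taylor_res_graded j)).
rewrite /taylor_deg -(subrK (degD (W (val i :\ a))) (degD (W (val i)))).
by apply: (gr_act (taylor_res_graded j)); [exact: taylor_coef_homog|exact: taylor_gen_homog].
Qed.

Lemma taylor_aug_homog : homogeneous_map (Tg 0) (@quotient_grading k n D phi N) 0 taylor_aug.
Proof.
apply: (homogeneous_gens (quotient_is_graded phi NP)) => i.
exists ('X_[W (val i)] : S); last first.
  rewrite taylor_augE; congr (quotmod_pi N _).
  by rewrite taylor_genE cards0 andbT eq_sym -cards_eq0 (valP i).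
by rewrite addr0; exact: poly_gradingX.
Qed.

Definition taylor_gres : graded_free_resolution phi (@quotient_grading k n D phi N) :=
  @GradedFreeResolution k n D phi _ _ taylor_res taylor_deg taylor_d_homog taylor_aug_homog.
End Graded.
End TaylorResolution.

(** * Cohomology of Taylor cochains *)

Section GradedCochains.
Variables (k : fieldType) (n r : nat) (g : 'I_r -> 'X_{1..n}).
Variables (D : zmodType) (phi : {additive 'rV[int]_n -> D}).
Local Notation S := {mpoly k[n]}.
Local Notation W := (mlcms g).
Local Notation degD := (Defs.mdegD phi).
Variable X : lmodType S.
Implicit Types (Zg : D -> set X) (d : D) (Q : pred nat) (c : {set 'I_r} -> X).

(** A graded subgroup of a module, closed under homogeneous polynomials; the
    kernel of a homogeneous map is one, without being packed as a module. *)
Record graded_sub Zg : Prop := GradedSub {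
  gs_zero : forall d, Zg d 0;
  gs_add : forall d x y, Zg d x -> Zg d y -> Zg d (x + y);
  gs_act : forall d e (p : S) x, poly_grading phi d p -> Zg e x -> Zg (d + e) (p *: x) }.

Lemma gs_opp Zg d x : graded_sub Zg -> Zg d x -> Zg d (- x).
Proof.
move=> gZ h; rewrite -scaleN1r -(add0r d); apply: (gs_act gZ) => //.
exact: (@poly_grading_sign _ _ _ _ 1).
Qed.

Lemma is_graded_sub Zg : is_graded phi Zg -> graded_sub Zg.
Proof. by move=> h; split; [exact: gr_zero h|exact: gr_add h|exact: gr_act h]. Qed.

(** The support is given by a predicate [Q] on the number of vertices: the cochains
    of degree [q - 1] are those with [Q a] when [a + 1 = q], and for [q = 0] there
    are none except [0]. *)
Definition gcochain Zg d Q c : Prop :=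
  forall I : {set 'I_r}, Zg (degD (W I) + d) (c I) /\ (~~ Q #|I| -> c I = 0).

Lemma gcochainD Zg d Q c c' : graded_sub Zg ->
  gcochain Zg d Q c -> gcochain Zg d Q c' -> gcochain Zg d Q (c + c').
Proof.
move=> gZ h h' I; have [z s] := h I; have [z' s'] := h' I; split.
  exact: (gs_add gZ).
by move=> qI; rewrite -[LHS]/(c I + c' I) s // s' // addr0.
Qed.

Lemma gcochainB Zg d Q c c' : graded_sub Zg ->
  gcochain Zg d Q c -> gcochain Zg d Q c' -> gcochain Zg d Q (c - c').
Proof.
move=> gZ h h'; apply: gcochainD => // I; have [z s] := h' I; split.
  exact: gs_opp.
by move=> qI; rewrite -[LHS]/(- c' I) s // oppr0.
Qed.

Lemma gcochain_delta Zg d Q Q' c : graded_sub Zg -> (forall a, Q a -> Q' a.+1) ->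
  gcochain Zg d Q c -> gcochain Zg d Q' (delta g c).
Proof.
move=> gZ QQ' h I; split=> [|qI].
  apply: (big_ind (Zg _)) => [|x y|a _]; [exact: (gs_zero gZ)|exact: (gs_add gZ)|].
  rewrite -(subrK (degD (W (I :\ a))) (degD (W I))) -addrA.
  by apply: (gs_act gZ); [exact: taylor_coef_homog|case: (h (I :\ a))].
rewrite /delta big1 // => a aI; case: (h (I :\ a)) => _ ->; first exact: scaler0.
by apply: contra qI => /QQ'; rewrite [#|I|](cardsD1 a) aI.
Qed.
End GradedCochains.

Section CochainsOfHom.
Variables (k : fieldType) (n r : nat) (g : 'I_r -> 'X_{1..n}).
Local Notation S := {mpoly k[n]}.
Local Notation W := (mlcms g).
Variable N : submodClosed S^o.
Hypothesis NP : forall p : S,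
  (p : S^o) \in N <-> (forall u, p@_u != 0 -> exists j, (g j <= u)%MM).
Local Notation T := (taylor_res NP).
Variable X : lmodType S.

Definition cochain_of p (f : lhom (T p) X) (I : {set 'I_r}) : X := f (taylor_gen k g p I).

Lemma delta_cochain_of p (f : lhom (T p) X) :
  delta g (cochain_of f) = cochain_of (lhom_comp f (res_d T p)).
Proof.
apply/funext => I; rewrite (delta_map g f).
exact: (congr1 f (esym (taylor_d_gen k g p I))).
Qed.

Lemma cochain_of_inj p (f f' : lhom (T p) X) : cochain_of f = cochain_of f' -> f = f'.
Proof. by move=> e; apply: taylor_ext => I; exact: (congr1 (@^~ I) e). Qed.

Lemma cochain_of_supp p (f : lhom (T p) X) (I : {set 'I_r}) :
  #|I| != p -> cochain_of f I = 0.
Proof. by move=> Ip; rewrite /cochain_of taylor_gen_supp // linear0. Qed.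

Lemma cochain_of_surj p (c : {set 'I_r} -> X) :
    (forall I : {set 'I_r}, #|I| != p -> c I = 0) ->
  exists f : lhom (T p) X, cochain_of f = c.
Proof. by move=> /(taylor_lhom g)[f fP]; exists f; apply/funext. Qed.

Lemma cocycle_delta i (z : cocycle T X i) : delta g (cochain_of (kermod_val z)) = 0.
Proof.
rewrite delta_cochain_of; have -> : lhom_comp (kermod_val z) (res_d T i) = 0.
  exact: (kermodP z).
by apply/funext.
Qed.

Lemma cocycle_of_delta i (c : {set 'I_r} -> X) :
    (forall I : {set 'I_r}, #|I| != i -> c I = 0) -> delta g c = 0 ->
  exists z : cocycle T X i, cochain_of (kermod_val z) = c.
Proof.
move=> /cochain_of_surj[f <-]; rewrite delta_cochain_of => f0.
have fd : lhom_pre X (res_d T i) f = 0.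
  by apply: cochain_of_inj; rewrite [LHS]f0; apply/funext.
by exists (mk_kermod fd).
Qed.

Lemma Ext_class_eq0 i (z : cocycle T X i) :
  quotmod_pi (@coboundary_pred _ _ T X i) z = 0 <->
  exists2 u, (forall I : {set 'I_r}, #|I|.+1 != i -> u I = 0) &
             cochain_of (kermod_val z) = delta g u.
Proof.
rewrite -(linear0 (quotmod_pi _)) quotmod_eq subr0.
have -> : (z \in @coboundary_pred _ _ T X i) <-> coboundary (kermod_val z).
  by split=> /asboolP.
move: (kermod_val z); case: i {z} => [|i] f.
  rewrite /coboundary; split=> [->|[u u0 e]].
    by exists 0 => //; rewrite raddf0; apply/funext.
  apply: cochain_of_inj; rewrite e; have -> : u = 0 by apply/funext => I; exact: u0.
  by rewrite raddf0; apply/funext.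
rewrite /coboundary; split=> [[w ->]|[u u0 e]].
  by exists (cochain_of w); [move=> I; exact: cochain_of_supp|rewrite delta_cochain_of].
have [w ew] := cochain_of_surj u0; exists w; apply: cochain_of_inj.
by rewrite e -ew delta_cochain_of.
Qed.

Section Graded.
Variables (D : zmodType) (phi : {additive 'rV[int]_n -> D}).
Local Notation degD := (Defs.mdegD phi).
Local Notation Tg := (taylor_gres NP phi).
Variable Xg : D -> set X.
Hypothesis gX : is_graded phi Xg.

Lemma homog_cochain_of i d (f : lhom (T i) X) :
  homogeneous_map (gres_grading Tg i) Xg d f <->
  gcochain g phi Xg d (pred1 i) (cochain_of f).
Proof.
split=> [h I|h].
  split; last by move=> Ii; rewrite cochain_of_supp.
  by apply: h; exact: taylor_gen_homog.
apply: (homogeneous_gens gX) => j; exact: (h (val j)).1.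
Qed.

(** The homogeneous components of [u] in the right degrees have the same coboundary,
    since the coefficients of [delta] are homogeneous. *)
Lemma gcochain_coboundary i d c u :
    gcochain g phi Xg d (pred1 i) c ->
    (forall I : {set 'I_r}, #|I|.+1 != i -> u I = 0) -> c = delta g u ->
  exists2 v, gcochain g phi Xg d [pred a | a.+1 == i] v & c = delta g v.
Proof.
move=> hc u0 e; exists (fun I => hcomp gX (degD (W I) + d) (u I)).
  move=> I; split; first exact: hcomp_homog.
  by move=> Ii; rewrite u0 // raddf0.
apply/funext => I; rewrite -(hcomp_id gX (hc I).1) [in LHS]e raddf_sum /=.
apply: eq_bigr => a _; rewrite -(hcompZ _ _ _ (@taylor_coef_homog k n r g D phi I a)).
by congr (hcomp gX _ _); rewrite addrAC [_ - _]addrC addrA subrr add0r.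
Qed.
End Graded.
End CochainsOfHom.

Section Transition.
Variables (k : fieldType) (n r : nat) (g g' : 'I_r -> 'X_{1..n}).
Local Notation S := {mpoly k[n]}.
Hypothesis gg' : forall j, (g j <= g' j)%MM.
Local Notation W := (mlcms g).
Local Notation W' := (mlcms g').

Lemma mlcms_le I : (W I <= W' I)%MM.
Proof.
apply/mlcmsP => j jI; apply: lepm_trans (gg' j) _.
exact: (mlcmsP g' I (W' I)).1 (lepm_refl _) j jI.
Qed.

(** Restriction of cochains along the inclusion of the Taylor complex of [g']
    in the one of [g]. *)
Definition cshift (X : lmodType S) (c : {set 'I_r} -> X) (I : {set 'I_r}) : X :=
  'X_[(W' I - W I)%MM] *: c I.

Lemma cshift_additive (X : lmodType S) : zmod_morphism (@cshift X).
Proof. by move=> c c'; apply/funext => I; exact: scalerBr. Qed.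
HB.instance Definition _ (X : lmodType S) :=
  GRing.isZmodMorphism.Build ({set 'I_r} -> X) ({set 'I_r} -> X) (@cshift X)
    (@cshift_additive X).

Lemma cshift_delta (X : lmodType S) (c : {set 'I_r} -> X) :
  cshift (delta g c) = delta g' (cshift c).
Proof.
apply/funext => I; rewrite /cshift /delta scaler_sumr; apply: eq_bigr => a aI.
rewrite !scalerA /taylor_coef mulrCA -!mulrA -!mpolyXD; congr (_ * 'X_[_] *: _).
have h1 := mlcms_sub g (finset.subsetDl I [set a]).
have h2 := mlcms_sub g' (finset.subsetDl I [set a]).
have h3 := mlcms_le I; have h4 := mlcms_le (I :\ a).
apply/mnmP => i; move/mnm_lepP/(_ i): h1; move/mnm_lepP/(_ i): h2.
move/mnm_lepP/(_ i): h3; move/mnm_lepP/(_ i): h4.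
rewrite !mnmDE !mnmBE => h4 h3 h2 h1.
by rewrite addnBA // subnK // addnBA // subnK.
Qed.

Lemma gcochain_shift (D : zmodType) (phi : {additive 'rV[int]_n -> D})
    (X : lmodType S) (Zg : D -> set X) d Q c : graded_sub phi Zg ->
  gcochain g phi Zg d Q c -> gcochain g' phi Zg d Q (cshift c).
Proof.
move=> gZ h I; case: (h I) => hI sI; split=> [|/sI e]; last by rewrite /cshift e scaler0.
rewrite -(subrK (Defs.mdegD phi (W I)) (Defs.mdegD phi (W' I))) -addrA.
apply: (gs_act gZ) => //; rewrite -degDB ?mlcms_le //; exact: poly_gradingX.
Qed.

Lemma cshift_map (X Y : lmodType S) (h : lhom X Y) (c : {set 'I_r} -> X) I :
  cshift (fun J => h (c J)) I = h (cshift c I).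
Proof. by rewrite /cshift linearZ. Qed.

Variables (N N' : submodClosed S^o).
Hypothesis NP : forall p : S,
  (p : S^o) \in N <-> (forall u, p@_u != 0 -> exists j, (g j <= u)%MM).
Hypothesis NP' : forall p : S,
  (p : S^o) \in N' <-> (forall u, p@_u != 0 -> exists j, (g' j <= u)%MM).
Variable f : lhom (quotmod N') (quotmod N).
Hypothesis fP : forall p, f (quotmod_pi N' p) = quotmod_pi N p.
Local Notation T := (taylor_res NP).
Local Notation T' := (taylor_res NP').

Fact taylor_incl_subproof p (t : taylor k g' p) : taylor_val t \in taylor_pred g p.
Proof.
apply/asboolP => I; split=> [|Ip]; last exact: taylor_supp.
have [q e] := taylor_dvd t I.
exists ('X_[(W' I - W I)%MM] * q).
by rewrite mulrA -mpolyXD addmC submK ?mlcms_le.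
Qed.
Definition taylor_incl_fun p (t : taylor k g' p) : taylor k g p :=
  Taylor (taylor_incl_subproof t).

Lemma taylor_inclE p (t : taylor k g' p) I : taylor_at (taylor_incl_fun t) I = taylor_at t I.
Proof. by []. Qed.

Fact taylor_incl_linear p : linear (@taylor_incl_fun p).
Proof. by move=> a t t'; exact/val_inj. Qed.
Definition taylor_incl p : lhom (taylor k g' p) (taylor k g p) :=
  mk_lhom (@taylor_incl_linear p).

Lemma taylor_incl_gen p I :
  taylor_incl p (taylor_gen k g' p I) = 'X_[(W' I - W I)%MM] *: taylor_gen k g p I.
Proof.
apply: taylorP => J Jp; rewrite taylorZE taylor_inclE !taylor_genE.
case: ifP => _; last by rewrite mulr0.
by rewrite -mpolyXD submK ?mlcms_le.
Qed.

(** In the realisation by divisibility the inclusion is the identity on faces, so it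
    commutes with differentials on the nose. *)
Lemma taylor_chain_map : exists c : chain_map T' T f, forall j, c j = taylor_incl j.
Proof.
have aug x : res_aug T (taylor_incl 0 x) = f (res_aug T' x).
  by rewrite [res_aug T' x]taylor_augE fP.
have dE j x : res_d T j (taylor_incl j.+1 x) = taylor_incl j (res_d T' j x).
  apply: taylorP => I _; rewrite [LHS]taylor_dE [RHS]taylor_inclE.
  by rewrite [RHS]taylor_dE.
by exists (@ChainMap _ _ _ T' T f taylor_incl aug dE).
Qed.

Lemma Ext_map_shift (X : lmodType S) i (z : cocycle T X i) (y : cocycle T' X i) :
  cochain_of (kermod_val y) = cshift (cochain_of (kermod_val z)) ->
  Ext_map T' T f X i (quotmod_pi _ z) = quotmod_pi _ y.
Proof.
have [c cE] := taylor_chain_map.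
move=> e; rewrite (Ext_mapE c) Ext_chain_mapE; congr quotmod_pi.
apply: val_inj; apply: (@cochain_of_inj _ _ _ _ _ NP'); rewrite [RHS]e.
apply/funext => I; rewrite /cochain_of /= cE taylor_incl_gen.
by rewrite linearZ.
Qed.
End Transition.

(** * Dimension shifting *)

Section Comparison.
Variables (k : fieldType) (n r : nat) (g g' : 'I_r -> 'X_{1..n}).
Variables (D : zmodType) (phi : {additive 'rV[int]_n -> D}).
Local Notation S := {mpoly k[n]}.
Hypothesis gg' : forall j, (g j <= g' j)%MM.

Section Comparisons.
Variables (X : lmodType S) (Zg : D -> set X) (d : D) (q : nat).

(** The restriction [cshift], from the Taylor cochains of [g] to those of [g'],
    is surjective, resp. injective, on cohomology classes of degree [(q, d)]. *)
Definition ext_surj : Prop := forall z,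
  gcochain g' phi Zg d (pred1 q) z -> delta g' z = 0 ->
  exists w u, [/\ gcochain g phi Zg d (pred1 q) w, delta g w = 0,
    gcochain g' phi Zg d [pred a | a.+1 == q] u & z = cshift g g' w + delta g' u].

Definition ext_inj : Prop := forall z u,
  gcochain g phi Zg d (pred1 q) z -> delta g z = 0 ->
  gcochain g' phi Zg d [pred a | a.+1 == q] u -> cshift g g' z = delta g' u ->
  exists2 v, gcochain g phi Zg d [pred a | a.+1 == q] v & z = delta g v.

Lemma ext_surj_large : graded_sub phi Zg -> (r < q)%N -> ext_surj.
Proof.
move=> gZ rq z hz _; have z0 Q h : gcochain h phi Zg d Q 0.
  by move=> I; split=> //; exact: (gs_zero gZ).
exists 0, 0; split=> //; first by rewrite raddf0.
apply/funext => I; rewrite !raddf0 addr0; apply: (hz I).2.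
by rewrite /= neq_ltn (leq_ltn_trans _ rq) // -[X in (_ <= X)%N]card_ord max_card.
Qed.

Lemma ext_inj_large : graded_sub phi Zg -> (r < q)%N -> ext_inj.
Proof.
move=> gZ rq z _ hz _ _ _; exists 0.
  by move=> I; split=> //; exact: (gs_zero gZ).
apply/funext => I; rewrite raddf0; apply: (hz I).2.
by rewrite /= neq_ltn (leq_ltn_trans _ rq) // -[X in (_ <= X)%N]card_ord max_card.
Qed.
End Comparisons.

(** Dimension shifting along a short exact sequence [0 -> K -> Y -> Z -> 0]: as
    cochains lift along [Y -> Z] face by face, the two four lemmas for the long exact
    sequences are carried out on cochains. *)
Section DimensionShift.
Variables (X Y : lmodType S) (p : lhom Y X) (Zg : D -> set X) (Yg : D -> set Y).
Hypotheses (gZ : graded_sub phi Zg) (gY : graded_sub phi Yg).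
Hypothesis p_homog : forall e y, Yg e y -> Zg e (p y).
Hypothesis p_surj : forall e x, Zg e x -> exists2 y, Yg e y & p y = x.
Definition ker_family (e : D) : set Y := [set y | Yg e y /\ p y = 0]%classic.
Local Notation Kg := ker_family.
Definition push (c : {set 'I_r} -> Y) (I : {set 'I_r}) : X := p (c I).

Lemma gcochain_push h d Q c : gcochain h phi Yg d Q c -> gcochain h phi Zg d Q (push c).
Proof.
move=> hc I; case: (hc I) => yI sI; split; first exact: p_homog.
by move=> /sI e; rewrite /push e linear0.
Qed.

Lemma gcochain_lift (h : 'I_r -> 'X_{1..n}) d Q c : gcochain h phi Zg d Q c ->
  exists2 y, gcochain h phi Yg d Q y & push y = c.
Proof.
move=> hc.
have /choice[y yP] I : exists y, [/\ Yg (Defs.mdegD phi (mlcms h I) + d) y,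
    p y = c I & ~~ Q #|I| -> y = 0].
  case: (hc I) => zI sI; have [QI|QI] := boolP (Q #|I|).
    by have [y yg <-] := p_surj zI; exists y.
  by exists 0; split; [exact: (gs_zero gY)|rewrite linear0 sI|].
exists y; last by apply/funext => I; case: (yP I).
by move=> I; case: (yP I).
Qed.

Lemma gcochain_ker (h : 'I_r -> 'X_{1..n}) d Q c :
  gcochain h phi Kg d Q c <-> gcochain h phi Yg d Q c /\ push c = 0.
Proof.
split=> [hc|[hc pc] I]; last first.
  by case: (hc I) => yI sI; split=> //; split=> //; exact: (congr1 (@^~ I) pc).
split=> [I|]; first by case: (hc I) => -[].
by apply/funext => I; case: (hc I) => -[].
Qed.

Lemma pushB (c c' : {set 'I_r} -> Y) : push (c - c') = (push c) - (push c').
Proof. by apply/funext => I; exact: linearB. Qed.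
Lemma pushD (c c' : {set 'I_r} -> Y) : push (c + c') = (push c) + (push c').
Proof. by apply/funext => I; exact: linearD. Qed.
Lemma push_delta h (c : {set 'I_r} -> Y) : push (delta h c) = delta h (push c).
Proof. by apply/funext => I; exact/esym/delta_map. Qed.
Lemma push_shift (c : {set 'I_r} -> Y) : push (cshift g g' c) = cshift g g' (push c).
Proof. by apply/funext => I; exact/esym/cshift_map. Qed.

Lemma ker_graded_sub : graded_sub phi Kg.
Proof.
split=> [e|e x y [hx px] [hy py]|e e' s x hs [hx px]].
- by split; [exact: (gs_zero gY)|exact: linear0].
- by split; [exact: (gs_add gY)|rewrite linearD /= px py addr0].
by split; [exact: (gs_act gY)|rewrite linearZ /= px scaler0].
Qed.

(** Lift [z] to [y]. Surjectivity for [K] writes [delta y] as a restriction plus a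
    coboundary, and injectivity for [Y] makes the former the restriction of a
    coboundary [delta v]; this corrects [y] to a cocycle of [Y], to which
    surjectivity for [Y] applies. *)
Lemma ext_surj_shift d q :
  ext_surj Yg d q -> ext_inj Yg d q.+1 -> ext_surj Kg d q.+1 -> ext_surj Zg d q.
Proof.
move=> sY iY sK z /gcochain_lift[y hy yz] dz.
have hdy : gcochain g' phi Kg d (pred1 q.+1) (delta g' y).
  apply/gcochain_ker; split; last by rewrite push_delta yz.
  by apply: gcochain_delta hy => // a.
have [w1 [u1 [/gcochain_ker[hw1 pw1] dw1 /gcochain_ker[hu1 pu1] e1]]] := sK _ hdy (deltaK _ _).
(* [e1] says that [cshift w1] is the coboundary of [y - u1]. *)
have [||v hv e2] := iY w1 (y - u1) hw1 dw1.
- exact: gcochainB.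
- by rewrite raddfB /= e1 addrK.
have [||w2 [u2 [hw2 dw2 hu2 e3]]] := sY (y - u1 - cshift g g' v).
- apply: gcochainB => //; first exact: gcochainB.
  exact: gcochain_shift.
- by rewrite !raddfB /= -cshift_delta // -e2 e1 addrK subrr.
exists (push (v + w2)), (push u2); split.
- by apply: gcochain_push; apply: gcochainD.
- by rewrite -push_delta raddfD /= dw2 addr0 -e2.
- exact: gcochain_push.
have -> : z = push (y - u1 - cshift g g' v) + push (cshift g g' v).
  by rewrite !pushB pu1 yz subr0 subrK.
rewrite e3 !pushD raddfD /= push_delta !push_shift addrC.
by rewrite addrA.
Qed.

(** Lift [z] to [y] and [u] to [u']. Injectivity for [K] corrects [y] to a cocycle;
    then [cshift (y - v) - delta u'] is a cocycle of [K], which surjectivity for [K]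
    absorbs, and injectivity for [Y] applies to what is left. *)
Lemma ext_inj_shift d q :
  ext_surj Kg d q -> ext_inj Yg d q -> ext_inj Kg d q.+1 -> ext_inj Zg d q.
Proof.
move=> sK iY iK z u /gcochain_lift[y hy yz] dz /gcochain_lift[u' hu' u'u] ez.
have hdy : gcochain g phi Kg d (pred1 q.+1) (delta g y).
  apply/gcochain_ker; split; last by rewrite push_delta yz.
  by apply: gcochain_delta hy => // a.
have hty : gcochain g' phi Kg d [pred a | a.+1 == q.+1] (cshift g g' y - delta g' u').
  apply/gcochain_ker; split; last first.
    by rewrite pushB push_shift push_delta yz u'u ez subrr.
  apply: gcochainB => //; first exact: gcochain_shift.
  by apply: gcochain_delta hu' => // a.
have [||v /gcochain_ker[hv pv] e1] := iK _ _ hdy _ hty; first exact: deltaK.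
  by rewrite raddfB /= deltaK subr0 cshift_delta.
have [||w [s [/gcochain_ker[hw pw] dw /gcochain_ker[hs ps] e2]]] :=
    sK (cshift g g' (y - v) - delta g' u').
- rewrite raddfB /= addrAC; apply: gcochainB => //; first exact: ker_graded_sub.
  apply: gcochain_shift => //; first exact: ker_graded_sub.
  by apply/gcochain_ker.
- by rewrite raddfB /= deltaK subr0 -cshift_delta // raddfB /= e1 subrr raddf0.
have [||||x hx e3] := iY (y - v - w) (u' + s).
- by apply: gcochainB => //; apply: gcochainB.
- by rewrite !raddfB /= dw e1 subrr subr0.
- exact: gcochainD.
- have -> : cshift g g' (y - v - w) = cshift g g' (y - v) - cshift g g' w.
    exact: raddfB.
  apply/eqP; rewrite subr_eq [delta g' (u' + s)]raddfD /= -addrA [delta g' s + _]addrC.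
  by rewrite -e2 addrC subrK.
exists (push x); first exact: gcochain_push.
by rewrite -push_delta -e3 !pushB pv pw !subr0.
Qed.
End DimensionShift.
End Comparison.

(** * Powers of square-free monomials *)

Section SquarefreePowers.
Variables (n r : nat) (L : 'I_r -> {set 'I_n}).

(** The [m]-th power of the square-free monomial with support [L j]. *)
Definition sqf_pow (m : nat) (j : 'I_r) : 'X_{1..n} := [multinom (m * (i \in L j))%N | i < n].

Lemma sqf_pow_le m m' j : (m <= m')%N -> (sqf_pow m j <= sqf_pow m' j)%MM.
Proof. by move=> mm'; apply/mnm_lepP => i; rewrite !mnmE leq_mul2r mm' orbT. Qed.

Lemma mlcms_sqf_pow m (I : {set 'I_r}) i :
  mlcms (sqf_pow m) I i = (m * [exists j in I, i \in L j])%N.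
Proof.
rewrite mnmE; apply/eqP; rewrite eqn_leq; apply/andP; split.
  apply/bigmax_leqP => j jI; rewrite mnmE leq_mul2l; apply/orP; right.
  case: (boolP (i \in L j)) => // ij.
  by rewrite (_ : [exists _ in _, _] = true) //; apply/existsP; exists j; rewrite jI.
case: (boolP [exists j in I, _]) => [/existsP[j /andP[jI ij]]|_]; last by rewrite muln0.
rewrite muln1 -[X in (X <= _)%N](_ : sqf_pow m j i = m); last by rewrite mnmE ij muln1.
exact: (@leq_bigmax_cond _ (mem I) (fun j => sqf_pow m j i) j jI).
Qed.

Variables (k : fieldType) (m m' : nat).
Hypothesis mm' : (m <= m')%N.
Local Notation S := {mpoly k[n]}.
Local Notation g := (sqf_pow m).
Local Notation g' := (sqf_pow m').
Local Notation W := (mlcms g).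
Local Notation W' := (mlcms g').

(** Dropping the terms that [W' I - W I] does not divide is compatible with the
    differentials: a variable that enters when [a] is added to [I :\ a] does so with
    exponent exactly [m], resp. [m'], so that divisibility of [u] by what enters is
    the same condition on both sides. *)
Lemma mdivX_taylor_coef (I : {set 'I_r}) a (p : S) : a \in I ->
  mdivX (W' I - W I)%MM (taylor_coef k g' I a * p) =
  taylor_coef k g I a * mdivX (W' (I :\ a) - W (I :\ a))%MM p.
Proof.
move=> aI; apply/mpolyP => u.
rewrite mcoeff_divX /taylor_coef -!mulrA !mcoeff_inc_sign !mcoeffXM mcoeff_divX.
congr (_ * _).
have sub i : [exists j in I :\ a, i \in L j] -> [exists j in I, i \in L j].
  move=> /existsP[j /andP[]]; rewrite !inE => /andP[_ jI] ij.
  by apply/existsP; exists j; rewrite jI.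
have -> : (W' I - W' (I :\ a) <= u + (W' I - W I))%MM = (W I - W (I :\ a) <= u)%MM.
  apply/mnm_lepP/mnm_lepP => h i; move: (h i) (sub i);
    rewrite ?mnmDE !mnmBE ?mnmDE ?mnmBE !mlcms_sqf_pow;
    case: [exists j in I, _]; case: [exists j in _, _] => //=; rewrite ?muln1 ?muln0; lia.
case: ifP => // /mnm_lepP h; congr (p@__); apply/mnmP => i; move: (h i) (sub i).
rewrite ?mnmDE !mnmBE ?mnmDE ?mnmBE !mlcms_sqf_pow.
case: [exists j in I, _]; case: [exists j in _, _] => //=; rewrite ?muln1 ?muln0; lia.
Qed.
End SquarefreePowers.

(** * Comparison for free modules *)

Section FreeComparison.
Variables (k : fieldType) (n r : nat) (L : 'I_r -> {set 'I_n}).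
Variables (m m' : nat) (mm' : (m <= m')%N).
Variables (D : zmodType) (phi : {additive 'rV[int]_n -> D}).
Local Notation S := {mpoly k[n]}.
Local Notation g := (sqf_pow L m).
Local Notation g' := (sqf_pow L m').
Local Notation W := (mlcms g).
Local Notation W' := (mlcms g').
Local Notation degD := (Defs.mdegD phi).

Lemma sqf_pow_mono j : (g j <= g' j)%MM.
Proof. exact: sqf_pow_le. Qed.
Local Notation gg' := sqf_pow_mono.

Section Free.
Variables (I : choiceType) (V : lmodType S) (b : I -> V) (deg : I -> D).
Hypothesis bb : is_basis b.
Local Notation Vg := (free_grading phi b deg).

Lemma basis_coord_sum_in e s (a : I -> S) : uniq s ->
  basis_coord bb e (\sum_(i <- s) a i *: b i) = if e \in s then a e else 0.
Proof. by move=> us; rewrite basis_coord_sum big_pick. Qed.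

Lemma mdivX_coord_exists v (x : V) :
  exists y : V, forall e, basis_coord bb e y = mdivX v (basis_coord bb e x : S).
Proof.
have [s [us x0 _]] := basis_coord_support bb x.
exists (\sum_(e <- s) mdivX v (basis_coord bb e x : S) *: b e) => e.
by rewrite basis_coord_sum_in //; case: ifP => // /negbT /x0 ->; rewrite raddf0.
Qed.

(** Divide the coordinates of [u] by the monomials of [cshift], discarding the terms
    that are not divisible: on [cshift z] this gives back [z], and it commutes with
    the differentials by [mdivX_taylor_coef]. *)
Lemma ext_inj_free d q : ext_inj g g' phi Vg d q.
Proof.
move=> z u hz dz hu e.
have /choice[v vP] J : exists y : V, forall e, basis_coord bb e y =
    mdivX (W' J - W J)%MM (basis_coord bb e (u J) : S) by exact: mdivX_coord_exists.
exists v => [J|].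
  case: (hu J) => /(free_gradingP phi deg bb) hJ sJ; split.
    apply/(free_gradingP phi deg bb) => e'; rewrite vP; apply/poly_gradingP => w.
    rewrite mcoeff_divX => hw; have := (poly_gradingP phi _ _).1 (hJ e') _ hw.
    rewrite degDD degDB ?(mlcms_le gg') // => hd.
    by apply: (addIr (degD (W' J) - degD (W J))); rewrite hd [RHS]addrC !addrA subrK.
  by move=> /sJ uJ; apply: (@basis_coord_inj _ _ _ _ bb) => e'; rewrite vP uJ !linear0 raddf0.
apply/funext => J; apply: (@basis_coord_inj _ _ _ _ bb) => e'.
have := congr1 (fun c => mdivX (W' J - W J)%MM (basis_coord bb e' (c J) : S)) e.
rewrite /cshift linearZ mdivXK => ->.
rewrite /delta !linear_sum raddf_sum /=; apply: eq_bigr => a aJ.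
by rewrite !linearZ /= vP; exact: mdivX_taylor_coef.
Qed.

Local Notation Sg := (poly_grading phi : D -> set S^o).

(** Solve for each coordinate of [z]; only finitely many are nonzero, so that the
    solutions can be reassembled. *)
Lemma ext_surj_free d q :
  (forall e, ext_surj g g' phi Sg (d - deg e) q) -> ext_surj g g' phi Vg d q.
Proof.
move=> sS z hz dz.
have /choice[supp suppP] x : exists s : seq I, forall e, e \notin s -> basis_coord bb e x = 0.
  by have [s [_ s0 _]] := basis_coord_support bb x; exists s.
(* All coordinates outside [s] vanish on every face. *)
pose s := undup (flatten [seq supp (z J) | J <- enum {: {set 'I_r}}]).
have us : uniq s by exact: undup_uniq.
have s0 e J : e \notin s -> basis_coord bb e (z J) = 0.
  move=> es; apply: suppP; apply: contra es => es; rewrite mem_undup.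
  by apply/flatten_mapP; exists J; rewrite ?mem_enum.
have sol e : exists wu : ({set 'I_r} -> S^o) * ({set 'I_r} -> S^o),
    [/\ gcochain g phi Sg (d - deg e) (pred1 q) wu.1, delta g wu.1 = 0,
    gcochain g' phi Sg (d - deg e) [pred a | a.+1 == q] wu.2 &
    (fun J => basis_coord bb e (z J)) = cshift g g' wu.1 + delta g' wu.2].
  have [||w [u h]] := sS e (fun J => basis_coord bb e (z J)); last by exists (w, u).
    move=> J; case: (hz J) => /(free_gradingP phi deg bb) hJ sJ; split.
      by rewrite addrA; exact: hJ.
    by move=> /sJ ->; rewrite linear0.
  by apply/funext => J; rewrite delta_map dz linear0.
have /choice[wu wuP] := sol.
pose asm (c : I -> {set 'I_r} -> S) (J : {set 'I_r}) := \sum_(e <- s) c e J *: b e.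
have asmE c e : (fun J => basis_coord bb e (asm c J)) = if e \in s then c e else (fun=> 0).
  by apply/funext => J; rewrite basis_coord_sum_in //; case: ifP.
have gS : graded_sub phi Sg.
  split=> *; [exact: poly_grading0|exact: poly_gradingD|exact: poly_gradingM].
have asmg h Q c : (forall e, gcochain h phi Sg (d - deg e) Q (c e)) ->
    gcochain h phi Vg d Q (asm c).
  move=> hc J; split.
    apply/(free_gradingP phi deg bb) => e; rewrite -addrA.
    rewrite -[basis_coord _ _ _]/((fun J => basis_coord bb e (asm c J)) J) asmE.
    case: ifP => _; [exact: (hc e J).1|exact: poly_grading0].
  by move=> QJ; rewrite /asm big1 // => e _; rewrite (hc e J).2 // scale0r.
exists (asm (fun e => (wu e).1)), (asm (fun e => (wu e).2)); split.
- by apply: asmg => e; case: (wuP e).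
- apply/funext => J; apply: (@basis_coord_inj _ _ _ _ bb) => e.
  rewrite linear0 -delta_map asmE; case: ifP => _; last first.
    exact: (congr1 (@^~ J) (raddf0 (@delta k n r g S^o))).
  by case: (wuP e) => _ -> _ _.
- by apply: asmg => e; case: (wuP e).
apply/funext => J; apply: (@basis_coord_inj _ _ _ _ bb) => e.
rewrite [(_ + _ : _ -> _) J]/(_ J + _ J) linearD /= -delta_map -cshift_map !asmE.
case: ifP => es.
  by case: (wuP e) => _ _ _ /(congr1 (@^~ J)).
rewrite s0 ?es //; apply/esym.
have -> : cshift g g' (fun=> 0 : S^o) = 0 by exact: raddf0.
have -> : delta g' (fun=> 0 : S^o) = 0 by exact: (raddf0 (@delta k n r g' S^o)).
exact: addr0.
Qed.
End Free.
End FreeComparison.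

(** * Induction along a free resolution *)

Section RingAsModule.
Variables (k : fieldType) (n : nat) (D : zmodType).
Variable phi : {additive 'rV[int]_n -> D}.
Local Notation S := {mpoly k[n]}.

Definition ring_gen (_ : unit) : S^o := 1.

Lemma ring_basis : is_basis ring_gen.
Proof.
split=> [x|s c us].
  exists [:: tt], (fun=> x); split=> //; rewrite big_seq1; exact/esym/mulr1.
rewrite (eq_bigr (fun i => if i == tt then c i : S else 0)); last first.
  by case=> _; exact: mulr1.
by rewrite (big_pick tt (c : unit -> S) us) => e [] is_; rewrite is_ in e.
Qed.

Lemma poly_grading_free :
  (poly_grading phi : D -> set S^o) = free_grading phi ring_gen (fun=> 0).
Proof.
apply/funext => d; apply/funext => x; apply/propext.
rewrite (free_gradingP phi (fun=> 0) ring_basis d x) subr0.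
have cE e : basis_coord ring_basis e x = x.
  have -> : x = (x : S) *: ring_gen tt by exact/esym/mulr1.
  rewrite linearZ /= basis_coordE; by case: e; rewrite eqxx.
by split=> [h e|/(_ tt)]; rewrite cE.
Qed.

Lemma poly_is_graded : is_graded phi (poly_grading phi : D -> set S^o).
Proof. by rewrite poly_grading_free; apply: free_is_graded ring_basis. Qed.
End RingAsModule.

Section SyzygyInduction.
Variables (k : fieldType) (n r : nat) (L : 'I_r -> {set 'I_n}).
Variables (m m' : nat) (mm' : (m <= m')%N).
Variables (D : zmodType) (phi : {additive 'rV[int]_n -> D}).
Local Notation S := {mpoly k[n]}.
Local Notation g := (sqf_pow L m).
Local Notation g' := (sqf_pow L m').

Lemma ext_inj_ring d q : ext_inj g g' phi (poly_grading phi : D -> set S^o) d q.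
Proof. by rewrite poly_grading_free; apply: ext_inj_free (ring_basis k n) _ _. Qed.

Variables (P : lmodType S) (Pg : D -> set P) (gP : is_graded phi Pg).
Variable F : graded_free_resolution phi Pg.
Local Notation gg' := (fun j => @sqf_pow_mono _ _ L _ _ mm' j).

(** The [j]-th syzygy, as a graded submodule of [F j]. *)
Definition syzygy (j : nat) : D -> set (F j) :=
  match j with
  | 0 => ker_family (res_aug F) (gres_grading F 0)
  | i.+1 => ker_family (res_d F i) (gres_grading F i.+1)
  end.

Lemma gres_graded_sub j : graded_sub phi (gres_grading F j).
Proof. exact/is_graded_sub/gres_graded. Qed.

Lemma syzygy_graded_sub j : graded_sub phi (@syzygy j).
Proof. by case: j => [|j]; apply: ker_graded_sub; exact: gres_graded_sub. Qed.

Lemma res_d_homog j e y : gres_grading F j.+1 e y -> syzygy e (res_d F j y).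
Proof.
move=> hy; have hd : gres_grading F j e (res_d F j y).
  by rewrite -(addr0 e); exact: (gres_d_homog hy).
case: j y hy hd => [|j] y hy hd; split=> //; last exact: res_dd.
by apply/res_exact0; exists y.
Qed.

Lemma res_d_onto j e x : syzygy e x ->
  exists2 y, gres_grading F j.+1 e y & res_d F j y = x.
Proof.
move=> sx; have [xg [y yx]] : gres_grading F j e x /\ exists y, res_d F j y = x.
  by case: j x sx => [|j] x [xg /=] => [/res_exact0|/res_exact].
exists (hcomp (gres_graded F j.+1) e y); first exact: hcomp_homog.
rewrite -(hcomp_lmap (gres_graded F j.+1) (gres_graded F j)).
  by rewrite yx hcomp_id.
exact: gres_d_homog.
Qed.

Lemma res_aug_onto e x : Pg e x -> exists2 y, gres_grading F 0 e y & res_aug F y = x.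
Proof.
move=> xg; have [y yx] := res_aug_surj F x.
exists (hcomp (gres_graded F 0) e y); first exact: hcomp_homog.
rewrite -(hcomp_lmap (gres_graded F 0) gP); first by rewrite yx hcomp_id.
exact: gres_aug_homog.
Qed.

Lemma ext_inj_res j d q : ext_inj g g' phi (gres_grading F j) d q.
Proof. exact: ext_inj_free (res_basis F j) _ _. Qed.

(** Induction on the room left between [q] and the number [r] of generators, beyond
    which there are no cochains. *)
Lemma ext_surj_syzygy d q j :
    (forall l, (j < l)%N -> ext_surj g g' phi (gres_grading F l) d (q + (l - j.+1))) ->
  ext_surj g g' phi (@syzygy j) d q.
Proof.
have [N rqN] : exists N, (r < q + N)%N by exists r.+1; rewrite addnS ltnS leq_addl.
elim: N q j rqN => [|N IH] q j rqN h.
  by apply: ext_surj_large; [exact: syzygy_graded_sub|rewrite -(addn0 q)].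
apply: (ext_surj_shift gg' (p := res_d F j) (gres_graded_sub j.+1)).
- exact: res_d_homog.
- exact: res_d_onto.
- by rewrite -[q]addn0 -(subnn j.+1); apply: h.
- exact: ext_inj_res.
apply: (IH q.+1 j.+1) => [|l jl]; first by rewrite addSnnS.
by have := h l (ltnW jl); rewrite (_ : (q + _ = q.+1 + (l - j.+2))%N) //; lia.
Qed.

Lemma ext_inj_syzygy d q j :
    (forall l, (j.+1 < l)%N -> ext_surj g g' phi (gres_grading F l) d (q + (l - j.+2))) ->
  ext_inj g g' phi (@syzygy j) d q.
Proof.
have [N rqN] : exists N, (r < q + N)%N by exists r.+1; rewrite addnS ltnS leq_addl.
elim: N q j rqN => [|N IH] q j rqN h.
  by apply: ext_inj_large; [exact: syzygy_graded_sub|rewrite -(addn0 q)].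
apply: (ext_inj_shift gg' (p := res_d F j) (gres_graded_sub j.+1)).
- exact: res_d_homog.
- exact: res_d_onto.
- exact: ext_surj_syzygy.
- exact: ext_inj_res.
apply: (IH q.+1 j.+1) => [|l jl]; first by rewrite addSnnS.
by have := h l (ltnW jl); rewrite (_ : (q + _ = q.+1 + (l - j.+3))%N) //; lia.
Qed.

Section Module.
Variables (d : D) (i : nat).
Hypothesis F_surj : forall j, ext_surj g g' phi (gres_grading F j) d (i + j).
Hypothesis F_surj_pred : forall j, (0 < j)%N ->
  ext_surj g g' phi (gres_grading F j) d (i + j - 1).

Lemma ext_surj_module : ext_surj g g' phi Pg d i.
Proof.
apply: (ext_surj_shift gg' (p := res_aug F) (gres_graded_sub 0)).
- by move=> e y hy; rewrite -(addr0 e); exact: (gres_aug_homog hy).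
- exact: res_aug_onto.
- by have := @F_surj 0%N; rewrite addn0.
- exact: ext_inj_res.
apply: (@ext_surj_syzygy d i.+1 0) => l l0.
by have := @F_surj l; rewrite (_ : (i + l = i.+1 + (l - 1))%N) //; lia.
Qed.

Lemma ext_inj_module : ext_inj g g' phi Pg d i.
Proof.
apply: (ext_inj_shift gg' (p := res_aug F) (gres_graded_sub 0)).
- by move=> e y hy; rewrite -(addr0 e); exact: (gres_aug_homog hy).
- exact: res_aug_onto.
- apply: (@ext_surj_syzygy d i 0) => l l0.
  by have := @F_surj_pred l l0; rewrite (_ : (i + l - 1 = i + (l - 1))%N) //; lia.
- exact: ext_inj_res.
apply: (@ext_inj_syzygy d i.+1 0) => l l1.
by have := @F_surj_pred l (ltnW l1); rewrite (_ : (i + l - 1 = i.+1 + (l - 2))%N) //; lia.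
Qed.
End Module.
End SyzygyInduction.

(** * From Taylor resolutions to arbitrary ones *)

Section MonomialIdeals.
Variables (k : fieldType) (n : nat).
Local Notation S := {mpoly k[n]}.

(** Membership in a monomial ideal is decided term by term. *)
Lemma mem_monomial_ideal (V : set 'X_{1..n}) (p : S) :
  p \in ideal_gen [set q : S | exists2 v, V v & q = 'X_[v]]%classic <->
  (forall u, p@_u != 0 -> exists2 v, V v & (v <= u)%MM).
Proof.
split=> [/asboolP[s [sV ->]] u|h].
  rewrite raddf_sum /= => su.
  have [x xs xu] : exists2 x, x \in s & (x.1 * x.2)@_u != 0.
    apply: contrapT => no; move/eqP: su; apply; rewrite big_seq big1 // => x xs.
    by apply/eqP/negP => /negP xu; apply: no; exists x.
  have [v Vv e] := sV _ xs; exists v => //.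
  by apply: (@mdvdX_supp _ _ v (x.1 * x.2) x.1) xu; rewrite e mulrC.
pose J := ideal_gen [set q : S | exists2 v, V v & q = 'X_[v]]%classic.
rewrite (mpolyE p) big_seq; apply: (big_ind (fun q : S => (q : S^o) \in J)).
- exact: (rpred0 J).
- by move=> q q'; exact: (@rpredD _ J).
move=> u; rewrite mcoeff_msupp => /h[v Vv vu].
have XJ : ('X_[v] : S^o) \in J by apply: ideal_gen_mem; exists v.
rewrite -{2}(submK vu) mpolyXD scalerAl.
exact: (rpredZ (p@_u *: 'X_[(u - v)%MM] : S) XJ).
Qed.

(** A monomial of [B] is a multiple of a square-free generator, so its [m]-th power is
    a multiple of the [m]-th power of that generator; and square-free monomials are
    finitely many. *)
Lemma sqf_bracket_power (B : {pred S^o}) : squarefree_monomial_ideal B ->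
  exists (r : nat) (L : 'I_r -> {set 'I_n}), forall m (p : S),
    (p : S^o) \in bracket_power B m <->
    (forall u, p@_u != 0 -> exists j, (sqf_pow L m j <= u)%MM).
Proof.
move=> [A [Asqf ->]].
pose ind (M : {set 'I_n}) : 'X_{1..n} := [multinom (i \in M : nat) | i < n].
pose gens : {set {set 'I_n}} := [set M | `[< A (ind M) >]].
exists #|gens|, (fun j => enum_val j) => m p.
have gensP u : A u -> exists j : 'I_#|gens|, ind (enum_val j) = u.
  move=> Au; have e : ind [set i | u i != 0%N] = u.
    by apply/mnmP => i; rewrite mnmE inE; have := Asqf _ Au i; case: (u i) => [|[|]].
  have M : [set i | u i != 0%N] \in gens by rewrite inE e; apply/asboolP.
  by exists (enum_rank_in M [set i | u i != 0%N]); rewrite enum_rankK_in.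
have powE j : sqf_pow (fun j : 'I_#|gens| => enum_val j) m j = (ind (enum_val j) *+ m)%MM.
  by apply/mnmP => i; rewrite mulmnE !mnmE mulnC.
have XB (v : 'X_{1..n}) : ('X_[v] : S^o) \in
    ideal_gen [set q : S | exists2 u, A u & q = 'X_[u]]%classic <->
    exists2 a, A a & (a <= v)%MM.
  rewrite mem_monomial_ideal; split=> [h|[a Aa av] u].
    by apply: h; rewrite mcoeffX eqxx oner_neq0.
  by rewrite mcoeffX; case: (v =P u) => [<- _|_]; [exists a|rewrite eqxx].
rewrite /bracket_power; set gen := (X in ideal_gen X).
have -> : gen = [set q : S | exists2 v, [set v | exists2 w, (exists2 a, A a & (a <= w)%MM) &
    v = (w *+ m)%MM]%classic v & q = 'X_[v]]%classic.
  apply/funext => q; apply/propext; split=> [[w /XB h ->]|[v [w /XB h ->] ->]].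
    by exists (w *+ m)%MM; [exists w|rewrite mpolyXn].
  by exists w => //; rewrite mpolyXn.
rewrite mem_monomial_ideal; split=> h u /h.
  move=> [v [w [a /gensP[j <-] aw] ->] wu]; exists j; rewrite powE.
  apply: lepm_trans wu; apply/mnm_lepP => i; rewrite !mulmnE leq_mul2r.
  by move/mnm_lepP: aw => ->; rewrite orbT.
move=> [j]; rewrite powE => ju; exists (ind (enum_val j) *+ m)%MM => //.
exists (ind (enum_val j)) => //; exists (ind (enum_val j)); last exact: lepm_refl.
by have := enum_valP j; rewrite inE => /asboolP.
Qed.
End MonomialIdeals.

(** Stated for a system given by its components, so that equalities in its limit are
    read off in these. *)
Lemma dl_map_eq (R : comNzRingType) (E : nat -> lmodType R)
    (e : forall m p, (m <= p)%N -> lhom (E m) (E p))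
    (e_id : forall m (h : (m <= m)%N) x, e m m h x = x)
    (e_comp : forall m p q (h : (m <= p)%N) (h' : (p <= q)%N) (h'' : (m <= q)%N) x,
       e p q h' (e m p h x) = e m q h'' x)
    m p (x : E m) (y : E p) :
  dl_map (DirectSystem e_id e_comp) m x = dl_map (DirectSystem e_id e_comp) p y <->
  exists q (h : (m <= q)%N) (h' : (p <= q)%N), e m q h x = e p q h' y.
Proof. exact: dl_inP. Qed.

Section Transfer.
Variables (k : fieldType) (n r : nat) (L : 'I_r -> {set 'I_n}).
Variables (D : zmodType) (phi : {additive 'rV[int]_n -> D}).
Local Notation S := {mpoly k[n]}.
Variable B : {pred S^o}.
Hypothesis BP : forall m (p : S), (p : S^o) \in bracket_power B m <->
  (forall u, p@_u != 0 -> exists j, (sqf_pow L m j <= u)%MM).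
Variable G : forall m, graded_free_resolution phi (quotient_grading phi (bracket_power B m)).
Local Notation T m := (taylor_gres (BP m) phi).
Local Notation g m := (sqf_pow L m).
Variables (X : lmodType S) (Xg : D -> set X) (gX : is_graded phi Xg).
Variables (i : nat) (d : D).

Local Notation proj h := (quot_bracket_proj B h).
Local Notation cl m := (quotmod_pi (@coboundary_pred _ _ (T m) X i)).
Local Notation co m z := (@cochain_of _ _ _ (g m) _ (BP m) X i (kermod_val z)).

Definition to_taylor m : lhom (Ext (G m) X i) (Ext (T m) X i) :=
  Ext_map (T m) (G m) (lhom_id _) X i.
Definition of_taylor m : lhom (Ext (T m) X i) (Ext (G m) X i) :=
  Ext_map (G m) (T m) (lhom_id _) X i.
Definition taylor_map m p (h : (m <= p)%N) : lhom (Ext (T m) X i) (Ext (T p) X i) :=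
  Ext_map (T p) (T m) (proj h) X i.
Definition res_map m p (h : (m <= p)%N) : lhom (Ext (G m) X i) (Ext (G p) X i) :=
  Ext_map (G p) (G m) (proj h) X i.

Lemma to_taylorK m x : of_taylor m (to_taylor m x) = x.
Proof.
by rewrite /of_taylor /to_taylor (Ext_map_comp _ _ _ (h := lhom_id _)) // Ext_map_id.
Qed.

Lemma of_taylorK m x : to_taylor m (of_taylor m x) = x.
Proof.
by rewrite /of_taylor /to_taylor (Ext_map_comp _ _ _ (h := lhom_id _)) // Ext_map_id.
Qed.

Lemma taylor_map_comp m p q (h : (m <= p)%N) (h' : (p <= q)%N) (h'' : (m <= q)%N) x :
  taylor_map h' (taylor_map h x) = taylor_map h'' x.
Proof.
apply: Ext_map_comp; elim/quotmod_ind => y.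
by rewrite (quot_bracket_projE B h' y) !quot_bracket_projE.
Qed.

Lemma to_taylor_ds m p (h : (m <= p)%N) x :
  to_taylor p (res_map h x) = taylor_map h (to_taylor m x).
Proof.
rewrite /to_taylor /taylor_map /res_map.
rewrite (Ext_map_comp _ _ _ (h := proj h)) //.
by rewrite (Ext_map_comp _ _ _ (h := proj h)).
Qed.

Lemma of_taylor_ds m p (h : (m <= p)%N) x :
  res_map h (of_taylor m x) = of_taylor p (taylor_map h x).
Proof.
rewrite /of_taylor /taylor_map /res_map.
rewrite (Ext_map_comp _ _ _ (h := proj h)) //.
by rewrite (Ext_map_comp _ _ _ (h := proj h)).
Qed.

Lemma Ext_grading_map m p (f : lhom (quot_bracket B p) (quot_bracket B m))
    (H : graded_free_resolution phi (quotient_grading phi (bracket_power B p)))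
    (H' : graded_free_resolution phi (quotient_grading phi (bracket_power B m))) x :
    (forall q, f (quotmod_pi _ q) = quotmod_pi _ q) ->
  Ext_grading H' Xg i d x -> Ext_grading H Xg i d (Ext_map H H' f X i x).
Proof.
move=> fP; apply: Ext_map_graded; first exact: quotient_is_graded (BP m).
by move=> e _ [q hq <-]; rewrite addr0 fP; exists q.
Qed.

Lemma taylor_map_shift m p (h : (m <= p)%N) (z : cocycle (T m) X i) :
  exists2 y : cocycle (T p) X i, taylor_map h (cl m z) = cl p y &
    co p y = cshift (g m) (g p) (co m z).
Proof.
have gg j : (g m j <= g p j)%MM by exact: sqf_pow_le.
have [y hy] : exists y : cocycle (T p) X i, co p y = cshift (g m) (g p) (co m z).
  apply: cocycle_of_delta => [I Ii|].
    by rewrite /cshift cochain_of_supp // scaler0.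
  by rewrite -(cshift_delta gg) cocycle_delta raddf0.
exists y => //; apply: (Ext_map_shift gg) => //.
exact: quot_bracket_projE.
Qed.

(** [taylor_map] is [cshift] on cocycles, and the coboundary that it hits can be
    taken homogeneous. *)
Lemma taylor_class_inj m p (h : (m <= p)%N) (z : cocycle (T m) X i) :
    ext_inj (g m) (g p) phi Xg d i ->
    gcochain (g m) phi Xg d (pred1 i) (co m z) ->
    taylor_map h (cl m z) = 0 ->
  exists2 v, gcochain (g m) phi Xg d [pred a | a.+1 == i] v & co m z = delta (g m) v.
Proof.
move=> inj hz; have [y -> hy] := taylor_map_shift h z.
have gg j : (g m j <= g p j)%MM by exact: sqf_pow_le.
move=> /Ext_class_eq0[u u0 eu].
have hc : gcochain (g p) phi Xg d (pred1 i) (co p y).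
  by rewrite hy; apply: gcochain_shift => //; exact: is_graded_sub.
have [v hv ev] := gcochain_coboundary gX hc u0 eu.
apply: (inj _ v) => //; last by rewrite -hy.
exact: cocycle_delta.
Qed.

Lemma Ext_grading_taylor m x : Ext_grading (T m) Xg i d x <->
  exists2 z, gcochain (g m) phi Xg d (pred1 i) (co m z) & cl m z = x.
Proof.
split=> [[z /(homog_cochain_of gX) hz <-]|[z hz <-]]; exists z => //.
exact/(homog_cochain_of gX).
Qed.

Lemma to_taylor_graded m x :
  Ext_grading (G m) Xg i d x -> Ext_grading (T m) Xg i d (to_taylor m x).
Proof. exact: Ext_grading_map. Qed.

Lemma of_taylor_graded m x :
  Ext_grading (T m) Xg i d x -> Ext_grading (G m) Xg i d (of_taylor m x).
Proof. exact: Ext_grading_map. Qed.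

Lemma Ext_to_local_eq m p (x : Ext (G m) X i) (y : Ext (G p) X i) :
  Ext_to_local_cohomology G X i m x = Ext_to_local_cohomology G X i p y <->
  exists q (h : (m <= q)%N) (h' : (p <= q)%N), res_map h x = res_map h' y.
Proof.
exact (@dl_map_eq S (fun j => Ext (G j) X i) res_map
         (@Ext_bracket_id k n B G X i) (@Ext_bracket_comp k n B G X i) m p x y).
Qed.

Lemma taylor_class_surj m p (h : (m <= p)%N) (y : cocycle (T p) X i) :
    ext_surj (g m) (g p) phi Xg d i ->
    gcochain (g p) phi Xg d (pred1 i) (co p y) ->
  exists2 z : cocycle (T m) X i, gcochain (g m) phi Xg d (pred1 i) (co m z) &
    taylor_map h (cl m z) = cl p y.
Proof.
move=> surj hy; have [w [u [hw dw hu e]]] := surj _ hy (cocycle_delta _).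
have [z ez] := cocycle_of_delta (BP m) (fun I => (hw I).2) dw.
exists z; first by rewrite ez.
have [y' -> ey'] := taylor_map_shift h z.
apply/eqP; rewrite eq_sym -subr_eq0 -linearB; apply/eqP/Ext_class_eq0.
exists u; first by move=> I; exact: (hu I).2.
have -> : co p (y - y') = co p y - co p y' by apply/funext.
by rewrite e ey' ez addrC addKr.
Qed.

(** Two elements of a direct limit are equal when they are equal at a later stage
    [p], and every element comes from a stage [p >= m]. *)
Lemma local_cohomology_bij m :
    (forall p, (m <= p)%N -> ext_inj (g m) (g p) phi Xg d i) ->
    (forall p, (m <= p)%N -> ext_surj (g m) (g p) phi Xg d i) ->
  set_bij (Ext_grading (G m) Xg i d) (local_cohomology_grading G Xg i d)
          (Ext_to_local_cohomology G X i m).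
Proof.
move=> inj surj; split.
- by move=> x hx; exists m => //; exists x.
- move=> x y /set_mem hx /set_mem hy /Ext_to_local_eq[p [h [h' e]]].
  have {}e : res_map h x = res_map h y by rewrite e (bool_irrelevance h' h).
  apply: (can_inj (to_taylorK (m := m))).
  have /Ext_grading_taylor[z hz ez] := to_taylor_graded hx.
  have /Ext_grading_taylor[z' hz' ez'] := to_taylor_graded hy.
  rewrite -ez -ez'; apply/eqP; rewrite -subr_eq0 -linearB; apply/eqP/Ext_class_eq0.
  have coB : co m (z - z') = co m z - co m z' by apply/funext.
  have [||v hv ev] := taylor_class_inj (h := h) (z := z - z') (inj _ h).
  + by rewrite coB; apply: gcochainB => //; exact: is_graded_sub.
  + have -> : taylor_map h (cl m (z - z')) = taylor_map h (cl m z) - taylor_map h (cl m z').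
      by rewrite !linearB.
    by rewrite ez ez' -!to_taylor_ds e subrr.
  by exists v => // I; exact: (hv I).2.
move=> _ [p _ [y hy <-]].
have hq := leq_maxr m p; have h := leq_maxl m p; set q := maxn m p in h hq.
have : Ext_grading (T q) Xg i d (to_taylor q (res_map hq y)).
  by apply: to_taylor_graded; apply: Ext_grading_map => //; exact: quot_bracket_projE.
case/Ext_grading_taylor => z hz ez.
have [w hw ew] := taylor_class_surj h (surj _ h) hz.
exists (of_taylor m (cl m w)).
  by apply: of_taylor_graded; apply/Ext_grading_taylor; exists w.
apply/Ext_to_local_eq; exists q, h, hq.
by rewrite of_taylor_ds ew ez to_taylorK.
Qed.

(** A class at stage [p] agrees in the limit with one coming from stage [m], hence at
    some stage [q]; injectivity from [p] to [q] makes them agree at stage [p]. *)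
Lemma ext_surj_of_bij m p : (m <= p)%N ->
    (forall q, (p <= q)%N -> ext_inj (g p) (g q) phi Xg d i) ->
    set_bij (Ext_grading (G m) Xg i d) (local_cohomology_grading G Xg i d)
          (Ext_to_local_cohomology G X i m) ->
  ext_surj (g m) (g p) phi Xg d i.
Proof.
move=> h inj [_ _ surj] c hc dc.
have [z ez] := cocycle_of_delta (BP p) (fun I => (hc I).2) dc.
have hy : Ext_grading (G p) Xg i d (of_taylor p (cl p z)).
  by apply: of_taylor_graded; apply/Ext_grading_taylor; exists z => //; rewrite ez.
have [x hx /Ext_to_local_eq[q [hm [hp e]]]] :
    (Ext_to_local_cohomology G X i m @` Ext_grading (G m) Xg i d)%classic
      (Ext_to_local_cohomology G X i p (of_taylor p (cl p z))).
  by apply: surj; exists p => //; exists (of_taylor p (cl p z)).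
have /Ext_grading_taylor[w hw ew] := to_taylor_graded hx.
have [y ey coy] := taylor_map_shift h w.
have coB : co p (z - y) = c - cshift (g m) (g p) (co m w).
  by rewrite -ez -coy; apply/funext.
have [||v hv ev] := taylor_class_inj (h := hp) (z := z - y) (inj _ hp).
- rewrite coB; apply: gcochainB => //; first exact: is_graded_sub.
  by apply: gcochain_shift; [move=> j; exact: sqf_pow_le|exact: is_graded_sub|].
- have -> : taylor_map hp (cl p (z - y)) = taylor_map hp (cl p z) - taylor_map hp (cl p y).
    by rewrite !linearB.
  rewrite -ey ew (taylor_map_comp _ _ hm) -to_taylor_ds e.
  by rewrite to_taylor_ds of_taylorK subrr.
exists (co m w), v; split=> //; first exact: cocycle_delta.
by rewrite -ev coB addrC subrK.
Qed.
End Transfer.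

(** * The theorem *)

Unset Implicit Arguments.
Local Open Scope classical_set_scope.

Theorem proposition4p1 (k : fieldType) (n : nat) (D : zmodType)
    (phi : {additive 'rV[int]_n -> D})
    (phi_surj : forall d : D, exists v : 'rV[int]_n, phi v = d)
    (B : {pred {mpoly k[n]}^o}) (B_sqfree : squarefree_monomial_ideal B)
    (G : forall m : nat,
       graded_free_resolution phi (quotient_grading phi (bracket_power B m)))
    (f : nat -> D -> nat) (f_pos : forall i d, (0 < f i d)%N)
    (f_iso : forall (d : D) (i m : nat), (f i d <= m)%N ->
       set_bij (Ext_grading (G m) (poly_grading phi) i d)
               (local_cohomology_grading G (poly_grading phi) i d)
               (Ext_to_local_cohomology G {mpoly k[n]}^o i m))
    (P : lmodType {mpoly k[n]}) (Pg : D -> set P)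
    (P_graded : is_graded phi Pg) (P_fg : finitely_generated P)
    (F : graded_free_resolution phi Pg)
    (i : nat) (d : D) (m : nat)
    (hm : forall (j : nat) (a : D), betti_neq0 F j a ->
       if j == 0%N then (f i (d - a)%R <= m)%N
       else (maxn (f (i + j - 1)%N (d - a)%R) (f (i + j)%N (d - a)%R) <= m)%N) :
  set_bij (Ext_grading (G m) Pg i d)
          (local_cohomology_grading G Pg i d)
          (Ext_to_local_cohomology G P i m).
Proof.
have [r [L BP]] := sqf_bracket_power B_sqfree.
have ring_surj p q e : (m <= p)%N -> (f q e <= m)%N ->
    ext_surj (sqf_pow L m) (sqf_pow L p) phi
      (poly_grading phi : D -> set {mpoly k[n]}^o) e q.
  move=> mp fm; apply: (ext_surj_of_bij BP (poly_is_graded k phi) mp _ (f_iso _ _ _ fm)).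
  by move=> l pl; exact: ext_inj_ring.
have F_surj p (mp : (m <= p)%N) j :
    ext_surj (sqf_pow L m) (sqf_pow L p) phi (gres_grading F j) d (i + j).
  apply: (ext_surj_free (res_basis F j)) => e; apply: ring_surj => //.
  have /hm : betti_neq0 F j (gres_deg e) by exists e.
  by case: j e => [|j] e /=; rewrite ?addn0 // geq_max => /andP[].
have F_surj_pred p (mp : (m <= p)%N) j : (0 < j)%N ->
    ext_surj (sqf_pow L m) (sqf_pow L p) phi (gres_grading F j) d (i + j - 1).
  move=> j0; apply: (ext_surj_free (res_basis F j)) => e; apply: ring_surj => //.
  have /hm : betti_neq0 F j (gres_deg e) by exists e.
  by case: j j0 e => [|j] // _ e /=; rewrite geq_max => /andP[].
apply: (local_cohomology_bij BP G P_graded) => p mp.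
  by apply: (ext_inj_module mp P_graded); exact: F_surj_pred.
by apply: (ext_surj_module mp P_graded); exact: F_surj.
Qed.
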